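(* Let $T$ be a strong mixing measure preserving transformation of a probability space $(\mathcal{X}, \mathcal{S}, \mu)$ and let $\mathcal{C} \subseteq \mathcal{S}$. (i) If $H_\mu(\mathcal{C}) = 0$, then $T$ is uniform strong mixing on $\mathcal{C}$, in the sense that $$\lim_{n \to \infty} \, \sup_{A, B \in \mathcal{C}} \left| \mu(A \cap T^{-n} B) - \mu(A)\mu(B) \right| = 0.$$ (ii) Suppose that $T$ is invertible and that $(\mathcal{X}, \mathcal{S}, \mu)$ is Lebesgue. If $H_\mu(\mathcal{C}) > 0$, then there exists a dense $G_\delta$ set $G \subset \Phi$ such that for each $\phi \in G$, $$\limsup_{n \to \infty} \, \sup_{C \in \mathcal{C}} \left| \mu(C \cap T_\phi^{-n} C) - \mu(C)^2 \right| > 0.$$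
   Context: A measure preserving transformation $T$ of $(\mathcal{X}, \mathcal{S}, \mu)$ is strong mixing if $\lim_{n\to\infty} |\mu(A \cap T^{-n} B) - \mu(A)\mu(B)| = 0$ for all $A, B \in \mathcal{S}$. A Lebesgue probability space is a probability space isomorphic (modulo null sets) to the unit interval $[0,1)$ with Lebesgue measure. $\Phi$ is the space of invertible measure preserving transformations of $(\mathcal{X}, \mathcal{S}, \mu)$, where transformations agreeing $\mu$-almost everywhere are identified, endowed with the weak topology: $\phi_r \to \phi$ if $\lim_{r\to\infty} \mu(\phi_r A \, \triangle \, \phi A) = 0$ for all $A \in \mathcal{S}$. For a measure preserving transformation $T$ and $\phi \in \Phi$, $T_\phi = \phi^{-1} \circ T \circ \phi$. Entropy of a family. For a finite measurable partition $\Pi$ of $\mathcal{X}$, $H_\mu(\Pi) = -\sum_{A \in \Pi} \mu(A) \log \mu(A)$, with logarithms base 2 (cells are assumed, without loss of generality, to have positive measure, i.e. null cells contribute 0). For measurable sets $C_1, \ldots, C_n$, the join $\vee_{i=1}^n C_i$ is the partition of $\mathcal{X}$ with cells $\tilde{C}_1 \cap \cdots \cap \tilde{C}_n$, where each $\tilde{C}_i \in \{C_i, C_i^c\}$. For an ordered sequence $\mathbb{S} = (C_1, C_2, \ldots)$ of sets $C_i \in \mathcal{C}$, let $H_\mu(\mathbb{S}) = \liminf_{n\to\infty} \frac{1}{n} H_\mu(\vee_{i=1}^n C_i)$. The entropy of the family $\mathcal{C} \subseteq \mathcal{S}$ is $H_\mu(\mathcal{C}) = \sup H_\mu(\mathbb{S})$,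 where the supremum is over all ordered sequences $\mathbb{S}$ of sets in $\mathcal{C}$. *)

(* Defs.v *)
From HB Require Import structures.
From mathcomp Require Import all_boot all_order all_algebra generic_quotient finmap.
From mathcomp Require Import all_classical all_reals all_analysis.

Set Implicit Arguments.
Unset Strict Implicit.
Unset Printing Implicit Defensive.

Import Order.TTheory GRing.Theory Num.Theory.
Import numFieldNormedType.Exports.

Local Open Scope classical_set_scope.
Local Open Scope ring_scope.

Section mixing.
Local Open Scope ereal_scope.
Context d (X : measurableType d) (R : realType).
Variable mu : probability X R.

Definition measure_preserving (T : X -> X) :=
  measurable_fun [set: X] T /\
  forall A, measurable A -> mu (T @^-1` A) = mu A.

Definition mixing_gap (T : X -> X) (n : nat) (A B : set X) : \bar R :=
  `|mu (A `&` iter n T @^-1` B) - mu A * mu B|.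

Definition strong_mixing (T : X -> X) :=
  forall A B, measurable A -> measurable B ->
    mixing_gap T n A B @[n --> \oo] --> 0.

End mixing.

Section entropy.
Context d (X : measurableType d) (R : realType).
Variable mu : probability X R.

(* Null cells contribute 0, since [ln 0 = 0]. *)
Definition partition_entropy (Pi : set (set X)) : R :=
  - \sum_(A \in Pi) fine (mu A) * (ln (fine (mu A)) / ln 2).

(* The n-th join only involves [C 0, ..., C n.-1].  It is a set of cells, so a
   cell (possibly the empty one) arising from several choices of signs is
   counted once. *)
Definition join (C : (set X)^nat) (n : nat) : set (set X) :=
  range (fun s : {ffun 'I_n -> bool} =>
           \bigcap_i (if s i then C i else ~` C i)).

Definition sequence_entropy (C : (set X)^nat) : \bar R :=
  limn_einf (fun n => (n%:R^-1 * partition_entropy (join C n))%:E).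

(* Equal to [-oo] when [F] is empty. *)
Definition family_entropy (F : set (set X)) : \bar R :=
  ereal_sup [set sequence_entropy C | C in
              [set C : (set X)^nat | forall i, F (C i)]].

End entropy.

Section lebesgue_space.
Local Open Scope ereal_scope.

(* The space [(X, mu)] and the restriction of [(Y, nu)] to [E] become
   isomorphic after removing a null set from each. *)
Definition isomorphic_mod0 d d' (X : measurableType d) (Y : measurableType d')
    (R : realType) (mu : probability X R) (nu : {measure set Y -> \bar R})
    (E : set Y) :=
  exists (X' : set X) (E' : set Y) (f : X -> Y),
    [/\ measurable X' /\ mu (~` X') = 0,
        [/\ measurable E', E' `<=` E & nu (E `\` E') = 0],
        set_bij X' E' f,
        measurable_fun X' f /\
          (forall A, measurable A -> A `<=` X' -> measurable (f @` A)) &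
        forall B, measurable B -> B `<=` E' -> mu (X' `&` f @^-1` B) = nu B].

(* Both usual models of the unit interval are admitted: the Borel
   sigma-algebra and its completion, the Lebesgue sigma-algebra. *)
Definition lebesgue_space d (X : measurableType d) (R : realType)
    (mu : probability X R) :=
  isomorphic_mod0 mu (@lebesgue_measure R) `[0%R, 1%R[%classic \/
  isomorphic_mod0 mu (@completed_lebesgue_measure R) `[0%R, 1%R[%classic.

End lebesgue_space.

Record inv_mpt d (X : measurableType d) (R : realType)
    (mu : probability X R) := InvMpt {
  imt_fun :> X -> X;
  imt_inv : X -> X;
  imt_measure_preserving : measure_preserving mu imt_fun;
  imt_inv_measurable : measurable_fun [set: X] imt_inv;
  imt_funK : cancel imt_fun imt_inv;
  imt_invK : cancel imt_inv imt_fun }.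

Section automorphisms.
Context d (X : measurableType d) (R : realType).
Variable mu : probability X R.

Definition invertible (T : X -> X) :=
  exists phi : inv_mpt mu, imt_fun phi = T.

Definition conjugate (T : X -> X) (phi : inv_mpt mu) : X -> X :=
  imt_inv phi \o T \o phi.

HB.instance Definition _ := gen_eqMixin (inv_mpt mu).
HB.instance Definition _ := gen_choiceMixin (inv_mpt mu).

Definition imt_ae_eq (phi psi : inv_mpt mu) : bool :=
  `[< {ae mu, forall x, phi x = psi x} >].

Let imt_ae_eq_refl : reflexive imt_ae_eq.
Proof. by move=> f; apply/asboolP; apply: aeW. Qed.

Let imt_ae_eq_sym : symmetric imt_ae_eq.
Proof.
by move=> f g; apply/idP/idP => /asboolP fg; apply/asboolP;
  apply: filterS fg => x ->.
Qed.

Let imt_ae_eq_trans : transitive imt_ae_eq.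
Proof.
move=> g f h /asboolP fg /asboolP gh; apply/asboolP.
by apply: filterS2 fg gh => x -> ->.
Qed.

Canonical imt_ae_eq_equiv :=
  EquivRel imt_ae_eq imt_ae_eq_refl imt_ae_eq_sym imt_ae_eq_trans.

Definition Phi : Type := {eq_quot imt_ae_eq}%qT.
HB.instance Definition _ := Choice.on Phi.
HB.instance Definition _ := EqQuotient.on Phi.

Definition class_of (phi : inv_mpt mu) : Phi := (\pi_Phi phi)%qT.

(* Does not depend, up to null sets, on the chosen representative. *)
Definition Phi_image (p : Phi) (A : set X) : set X := repr p @` A.

Definition Phi_nbhs (p : Phi) (A : set X) (e : R) : set Phi :=
  [set q | (mu (Phi_image q A `+` Phi_image p A) < e%:E)%E].

Definition weak_subbase : set (set Phi) :=
  [set U | exists p A e, [/\ measurable A, 0 < e & U = Phi_nbhs p A e]].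

HB.instance Definition _ :=
  isSubBaseTopological.Build Phi weak_subbase (@id (set Phi)).

End automorphisms.

Section weak_topology.
Context d (X : measurableType d) (R : realType).
Variable mu : probability X R.

Lemma repr_class_of (phi : inv_mpt mu) :
  {ae mu, forall x, repr (class_of phi) x = phi x}.
Proof.
by apply/asboolP; have /eqmodP := reprK (class_of phi).
Qed.

Lemma measurable_Phi_image (p : Phi mu) (A : set X) :
  measurable A -> measurable (Phi_image p A).
Proof.
move=> mA; rewrite /Phi_image.
have -> : repr p @` A = imt_inv (repr p) @^-1` A.
  rewrite eqEsubset; split => [_ [x Ax <-]|x Ax] /=; first by rewrite imt_funK.
  by exists (imt_inv (repr p) x) => //; rewrite imt_invK.
by rewrite -[X in measurable X]setTI; apply: imt_inv_measurable.
Qed.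

(* The topology has the intended convergent sequences. *)
Lemma weak_cvgE (u : (Phi mu)^nat) (p : Phi mu) :
  u @ \oo --> p <->
  forall A, measurable A ->
    mu (Phi_image (u n) A `+` Phi_image p A) @[n --> \oo] --> 0%E.
Proof.
have mY (q r : Phi mu) A : measurable A ->
    measurable (Phi_image q A `+` Phi_image r A).
  by move=> mA; apply: measurableU; apply: measurableD;
    apply: measurable_Phi_image.
split=> [up A mA|H].
  apply/fine_cvgP; split.
    by apply: nearW => n; rewrite fin_num_measure//; exact: mY.
  apply/cvgrPdist_lt => e e0.
  have /up : nbhs p (Phi_nbhs p A e).
    rewrite nbhsE; exists (Phi_nbhs p A e) => //; split; last first.
      by rewrite /Phi_nbhs /= /setY setDv setU0 measure0 lte_fin.
    exists [set Phi_nbhs p A e]; last by rewrite bigcup_set1.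
    move=> _ ->; exists [fset Phi_nbhs p A e]%fset.
      by move=> V /fset1P ->; apply/mem_set; exists p, A, e.
    by rewrite eqEsubset; split => q /=; [move=> h; apply: h; exact/fset1P|
       move=> Hq V /fset1P ->].
  move=> upA; near=> n.
  have Hn : (mu (Phi_image (u n) A `+` Phi_image p A) < e%:E)%E
    by near: n; exact: upA.
  rewrite sub0r normrN ger0_norm ?fine_ge0//.
  by rewrite -lte_fin fineK// fin_num_measure//; exact: mY.
move=> U; rewrite nbhsE => -[_ [[B sB <-] [C BC Cp]] sU].
rewrite nbhs_filterE; apply: filterS sU _; apply: (@filterS _ _ _ C).
  by move=> ? ?; exists C.
have /sB [D sD IDeC] := BC; rewrite -IDeC; apply: filter_bigI => E DE.
have /sD := DE; rewrite inE => -[r [A [e [mA e0 EE]]]].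
have : E p by move: Cp; rewrite -IDeC => /(_ _ DE).
rewrite EE /Phi_nbhs /= => pr.
have fin (q s : Phi mu) : mu (Phi_image q A `+` Phi_image s A) \is a fin_num.
  by rewrite fin_num_measure//; apply: mY.
have pos : 0 < e - fine (mu (Phi_image p A `+` Phi_image r A)).
  by rewrite subr_gt0 -lte_fin fineK.
have /fine_cvgP[_ /cvgrPdist_lt /(_ _ pos)] := H A mA.
rewrite nbhs_filterE; apply: filterS => n /=.
rewrite sub0r normrN ger0_norm ?fine_ge0// => un.
have : (mu (Phi_image (u n) A `+` Phi_image r A) <=
   mu (Phi_image (u n) A `+` Phi_image p A) +
   mu (Phi_image p A `+` Phi_image r A))%E.
  apply: (@le_trans _ _ (mu ((Phi_image (u n) A `+` Phi_image p A) `|`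
                           (Phi_image p A `+` Phi_image r A)))).
    apply: le_measure; rewrite ?inE; [exact: mY|by apply: measurableU; exact: mY|].
    move=> x; rewrite /setY /=.
    by case: (pselect (Phi_image p A x)); tauto.
  by apply: measureU2; exact: mY.
move/le_lt_trans; apply.
by rewrite -(fineK (fin _ _)) -(fineK (fin p r)) -EFinD lte_fin -ltrBrDr.
Unshelve. all: by end_near. Qed.

End weak_topology.

(* Main.v *)
(* Both parts go through the same dichotomy.  Call F approximable if for every
   e > 0 there is a finite partition such that each C in F is e-close to a union
   of its cells.  If F is approximable, refining a partition by one more C in F
   adds little entropy, so the entropy of F is 0, and mixing on F reduces to
   mixing on finitely many sets.  If F is not approximable at scale e, every finite
   partition can be refined by some C in F so that the entropy grows by at least e
   bits; iterating, F has positive entropy.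

   For (ii), let F be non-approximable at scale e.  Given an automorphism phi and a
   finite partition, pick C in F far from the unions of cells, put D = phi C, and
   let S = T^n with n large.  Fix a set G of small measure g, nearly independent of
   the cells.  By mixing, an involution that is locally a power of T exchanges a
   part of {x in G & D, Sx in D \ G} with an equal part of
   {x in G \ D, Sx not in D and not in G}, preserving the cells of x and of Sx.
   Applying or not this involution and its conjugate by S to D gives four sets, and
   the mixed second difference of mu (D & S^-1 D) over them is at least of order
   g e^2 - g^2, so that one of them correlates with its preimage under S by an
   amount bounded below in terms of e only.

   The corresponding subsets of Phi are thus open and dense.  Their intersection is
   dense because a sequence of such perturbations preserving finer and finer
   partitions, both in the domain and in the range, converges: in a Lebesgue
   coordinate u, the functions u \o phi_j and u \o phi_j^-1 converge uniformly, and
   their limits come from mutually inverse maps. *)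
Require Import Defs.
From HB Require Import structures.
From mathcomp Require Import all_boot all_order all_algebra generic_quotient finmap.
From mathcomp Require Import all_classical all_reals all_analysis.
From mathcomp Require Import borel_hierarchy measurable_realfun ring lra.

Set Implicit Arguments.
Unset Strict Implicit.
Unset Printing Implicit Defensive.

Import Order.TTheory GRing.Theory Num.Theory.
Import numFieldNormedType.Exports.

Local Open Scope classical_set_scope.
Local Open Scope ring_scope.

(** * Finite labels and their entropy *)

Section probability_calculus.
Context d (X : measurableType d) (R : realType) (mu : probability X R).
Implicit Types A B C : set X.

Definition pr (A : set X) : R := fine (mu A).

Lemma prE A : measurable A -> mu A = (pr A)%:E.
Proof. by move=> mA; rewrite /pr fineK// fin_num_measure. Qed.

Lemma pr_ge0 A : 0 <= pr A.
Proof. by rewrite fine_ge0. Qed.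

Lemma pr_setT : pr [set: X] = 1.
Proof. by rewrite /pr probability_setT. Qed.

Lemma pr_set0 : pr set0 = 0.
Proof. by rewrite /pr measure0. Qed.

(** Integrating sums of indicators turns a pointwise count into an inequality of measures. The
    finite estimates below thus reduce to Boolean case analysis. *)
Lemma pr_count_le (s t : seq (set X)) :
  (forall A, A \in s -> measurable A) -> (forall B, B \in t -> measurable B) ->
  (forall x, (\sum_(A <- s) `[< A x >] <= \sum_(B <- t) `[< B x >])%N) ->
  \sum_(A <- s) pr A <= \sum_(B <- t) pr B.
Proof.
move=> ms mt st.
pose cnt (r : seq (set X)) x : R := (\sum_(A <- r) `[< A x >])%N%:R.
have cntE A r x : cnt (A :: r) x = \1_A x + cnt r x.
  by rewrite /cnt big_cons natrD indicE /in_mem.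
have mcnt r : (forall A, A \in r -> measurable A) ->
    measurable_fun [set: X] (cnt r).
  elim: r => [|A r IH] mr.
    by rewrite (_ : cnt _ = cst 0)//; apply/funext => x; rewrite /cnt big_nil.
  rewrite (_ : cnt _ = \1_A \+ cnt r); last by apply/funext => x; rewrite cntE.
  apply: measurable_funD; first by apply: measurable_indic; exact/mr/mem_head.
  by apply: IH => B Br; apply: mr; rewrite inE Br orbT.
have mE (f : X -> R) : measurable_fun [set: X] f ->
    measurable_fun [set: X] (fun x => (f x)%:E).
  by move=> mf; apply/measurable_EFinP.
have intE r : (forall A, A \in r -> measurable A) ->
    (\sum_(A <- r) pr A)%:E = (\int[mu]_x (cnt r x)%:E)%E.
  elim: r => [|A r IH] mr.
    by rewrite big_nil integral0_eq// => x _; rewrite /cnt big_nil.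
  have mA : measurable A by exact: (mr _ (mem_head _ _)).
  have mr' B : B \in r -> measurable B by move=> Br; apply: mr; rewrite inE Br orbT.
  under eq_integral do rewrite cntE EFinD.
  rewrite big_cons EFinD IH// ge0_integralD//.
  - by rewrite integral_indic// setIT; congr (_ + _)%E; exact/esym/prE.
  - exact/mE/measurable_indic.
  - by move=> x _; rewrite lee_fin ler0n.
  - exact/mE/mcnt.
rewrite -lee_fin !intE//; apply: ge0_le_integral => //.
- by move=> x _; rewrite lee_fin ler0n.
- exact/mE/mcnt.
- exact/mE/mcnt.
- by move=> x _; rewrite lee_fin ler_nat.
Qed.

Lemma pr_count_eq (s t : seq (set X)) :
  (forall A, A \in s -> measurable A) -> (forall B, B \in t -> measurable B) ->
  (forall x, (\sum_(A <- s) `[< A x >] = \sum_(B <- t) `[< B x >])%N) ->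
  \sum_(A <- s) pr A = \sum_(B <- t) pr B.
Proof.
by move=> ms mt st; apply/eqP; rewrite eq_le !pr_count_le// => x; rewrite st.
Qed.

Lemma pr_le A B : measurable A -> measurable B -> A `<=` B -> pr A <= pr B.
Proof.
by move=> mA mB AB; rewrite fine_le ?fin_num_measure// le_measure ?inE.
Qed.

Lemma pr_le1 A : measurable A -> pr A <= 1.
Proof. by move=> mA; rewrite -pr_setT pr_le. Qed.

Lemma pr_leU A B C : measurable A -> measurable B -> measurable C ->
  A `<=` B `|` C -> pr A <= pr B + pr C.
Proof.
move=> mA mB mC ABC; have := @pr_count_le [:: A] [:: B; C].
rewrite !big_cons !big_nil !addr0; apply => [E|E|x].
- by rewrite inE => /eqP ->.
- by rewrite !inE => /orP[]/eqP ->.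
- rewrite !big_cons !big_nil; have := ABC x; rewrite /setU/=.
  by do 3![case: asboolP => //= ?]; tauto.
Qed.

Lemma pr_split A B : measurable A -> measurable B ->
  pr A = pr (A `&` B) + pr (A `\` B).
Proof.
move=> mA mB; have := @pr_count_eq [:: A] [:: A `&` B; A `\` B].
rewrite !big_cons !big_nil !addr0; apply => [E|E|x].
- by rewrite inE => /eqP ->.
- by rewrite !inE => /orP[]/eqP ->; [exact: measurableI|exact: measurableD].
- rewrite !big_cons !big_nil /setI /setD/=.
  by do 3![case: asboolP => //= ?]; tauto.
Qed.

Lemma pr_setC A : measurable A -> pr (~` A) = 1 - pr A.
Proof.
by move=> mA; rewrite -pr_setT (pr_split measurableT mA) setTI setTD addrC addKr.
Qed.

Section labels.
Variable K : finType.
Implicit Types a : X -> K.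

(** A finite measurable partition is encoded as a map to a finite type whose fibres are the cells;
    some fibres may be empty. *)
Definition label a := forall k, measurable (a @^-1` [set k]).

Lemma measurable_label a (P : set K) : label a -> measurable (a @^-1` P).
Proof.
move=> la; rewrite (_ : _ @^-1` _ = \bigcup_(k in P) (a @^-1` [set k])).
  exact: fin_bigcup_measurable.
apply/seteqP; split=> [x Px|x [k Pk akx]]; first by exists (a x).
by rewrite /preimage/= akx.
Qed.

Lemma pr_label a A : label a -> measurable A ->
  pr A = \sum_k pr (A `&` a @^-1` [set k]).
Proof.
move=> la mA.
have := @pr_count_eq [:: A] [seq A `&` a @^-1` [set k] | k <- enum K].
rewrite big_cons big_nil addr0 big_map big_enum; apply => [E|E|x].
- by rewrite inE => /eqP ->.
- by move=> /mapP[k _ ->]; exact: measurableI.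
- rewrite big_cons big_nil addn0 big_map big_enum /=.
  rewrite (bigD1 (a x))//= big1 ?addn0 => [|k kx].
    by congr (nat_of_bool _); apply/asboolP/asboolP => [|[]].
  by case: asboolP => // -[_ /esym/eqP]; rewrite (negPf kx).
Qed.

End labels.

Lemma label_comp (K L : finType) (a : X -> K) (g : K -> L) :
  label a -> label (g \o a).
Proof. by move=> la l; exact: (measurable_label (g @^-1` [set l])). Qed.

Lemma label_pair (K L : finType) (a : X -> K) (b : X -> L) :
  label a -> label b -> label (fun x => (a x, b x)).
Proof.
move=> la lb [k l]; rewrite (_ : _ @^-1` _ = a @^-1` [set k] `&` b @^-1` [set l]).
  exact: measurableI.
by apply/seteqP; split=> x /= [-> ->].
Qed.

Lemma label_mem A : measurable A -> label (fun x => `[< A x >]).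
Proof.
move=> mA [].
  by rewrite (_ : _ @^-1` _ = A)//; apply/seteqP; split=> x /asboolP.
rewrite (_ : _ @^-1` _ = ~` A); first exact: measurableC.
by apply/seteqP; split=> x /=; [move/negbT/asboolPn|move=> ?; exact/asboolPn].
Qed.

End probability_calculus.

(** * The function [- p ln p] and the entropy gained by splitting a cell *)

Section eta.
Context (R : realType).
Implicit Types p q t : R.

Definition eta p : R := - (p * ln p).

Lemma eta0 : eta 0 = 0. Proof. by rewrite /eta mul0r oppr0. Qed.

Lemma eta_ge0 p : 0 <= p <= 1 -> 0 <= eta p.
Proof. by move=> /andP[p0 p1]; rewrite /eta -mulrN mulr_ge0// oppr_ge0 ln_le0. Qed.

Lemma eta_gap p q : 0 < p -> 0 < q ->
  eta p + eta q - eta (p + q) = - (p * ln (p / (p + q))) - q * ln (q / (p + q)).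
Proof.
move=> p0 q0; have s0 : 0 < p + q by rewrite addr_gt0.
by rewrite !ln_div ?posrE// /eta; ring.
Qed.

(** If [p <= q] then [p / (p + q) <= 1 / 2], so the first term of [eta_gap] is at least [p * ln 2];
    the second is nonnegative. *)
Lemma eta_gap_ge p q : 0 <= p -> 0 <= q ->
  ln 2 * Num.min p q <= eta p + eta q - eta (p + q).
Proof.
move=> p0 q0; move: p0; rewrite le_eqVlt => /orP[/eqP<-|p0].
  by rewrite eta0 !add0r subrr (min_idPl q0) mulr0.
move: q0; rewrite le_eqVlt => /orP[/eqP<-|q0].
  by rewrite eta0 !addr0 subrr (min_idPr (ltW p0)) mulr0.
wlog pq : p q p0 q0 / p <= q.
  move=> H; have /orP[|] := le_total p q; first exact: H.
  by move=> /(H _ _ q0 p0); rewrite minC [q + p]addrC [eta q + _]addrC.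
have s0 : 0 < p + q by rewrite addr_gt0.
rewrite eta_gap// (min_idPl pq) -subr_ge0.
have : ln (p / (p + q)) <= - ln 2.
  rewrite -lnV ?posrE// ler_ln ?posrE ?invr_gt0 ?divr_gt0//.
  by rewrite ler_pdivrMr//; lra.
have : ln (q / (p + q)) <= 0 by rewrite ln_le0// ler_pdivrMr//; lra.
by nra.
Qed.

(** Gibbs' inequality: the entropy of the split is at most its cross entropy with respect to the
    weights [1 - t] and [t]. The bound is linear in [p] and [q], hence can be summed over cells. *)
Lemma eta_gap_le p q t : 0 <= p -> 0 <= q -> 0 < t < 1 ->
  eta p + eta q - eta (p + q) <= - (p * ln (1 - t)) - q * ln t.
Proof.
move=> p0 q0 /andP[t0 t1].
have lnt : ln t <= 0 by rewrite ln_le0// ltW.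
have lnt1 : ln (1 - t) <= 0 by rewrite ln_le0//; lra.
move: p0; rewrite le_eqVlt => /orP[/eqP<-|p0].
  by rewrite eta0 !add0r subrr mul0r oppr0 add0r; nra.
move: q0; rewrite le_eqVlt => /orP[/eqP<-|q0].
  by rewrite eta0 !addr0 subrr mul0r subr0; nra.
have s0 : 0 < p + q by rewrite addr_gt0.
have lnB (x : R) : 0 < x -> ln x <= x - 1.
  by move=> x0; rewrite -[X in ln X](subrKC 1) le_ln1Dx//; lra.
(* This is [ln x <= x - 1]. In the instances [(p, 1 - t)] and [(q, t)] the right-hand sides add up
   to 0. *)
have gibbs r u : 0 < r -> 0 < u ->
    r * (ln u - ln (r / (p + q))) <= u * (p + q) - r.
  move=> r0 u0; rewrite -ln_div ?posrE ?divr_gt0//.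
  have -> : u * (p + q) - r = r * (u / (r / (p + q)) - 1).
    by field; rewrite !gt_eqF.
  by rewrite ler_pM2l// lnB// !divr_gt0.
rewrite eta_gap//.
have u0 : 0 < 1 - t by lra.
have := gibbs _ _ p0 u0; have := gibbs _ _ q0 t0; lra.
Qed.

Lemma eta_sum (I : finType) (P : pred I) (p : I -> R) : (forall i, 0 <= p i) ->
  eta (\sum_(i | P i) p i) <= \sum_(i | P i) eta (p i).
Proof.
move=> p0; suff [] : 0 <= \sum_(i | P i) p i /\
  eta (\sum_(i | P i) p i) <= \sum_(i | P i) eta (p i) by [].
apply: (big_ind2 (fun x y => 0 <= x /\ eta x <= y)) => //.
- by rewrite eta0.
- move=> x1 y1 x2 y2 [x10 h1] [x20 h2]; split; first exact: addr_ge0.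
  have := eta_gap_ge x10 x20.
  have : 0 <= ln 2 * Num.min x1 x2.
    by rewrite mulr_ge0 ?ln_ge0 ?ler1n// le_min x10.
  by lra.
Qed.

End eta.

(** * Entropy of labels under coarsening and under refinement by one set *)

Section entropy_of_labels.
Context d (X : measurableType d) (R : realType) (mu : probability X R).
Local Notation pr := (pr mu).

Definition ent (K : finType) (a : X -> K) : R :=
  \sum_k eta (pr (a @^-1` [set k])).

(** A cell of [g \o a] is a union of cells of [a], and [eta] is subadditive. *)
Lemma ent_comp (K L : finType) (a : X -> K) (g : K -> L) :
  label a -> ent (g \o a) <= ent a.
Proof.
move=> la; rewrite /ent [leRHS](partition_big g predT)//=.
apply: ler_sum => l _; rewrite (pr_label mu la); last exact: label_comp.
rewrite [X in eta X](_ : _ = \sum_(k | g k == l) pr (a @^-1` [set k])).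
  by apply: eta_sum => k; exact: pr_ge0.
rewrite [RHS]big_mkcond/=; apply: eq_bigr => k _.
case: eqVneq => [<-|/eqP gkl].
  by congr (pr _); apply/seteqP; split => x /=; [case|move=> ->].
rewrite -[RHS](pr_set0 mu); congr (pr _); apply/seteqP; split=> x //= [gl ak].
by apply: gkl; rewrite -ak.
Qed.

(** The symmetric difference of [C] and the union of the cells selected by [P]. *)
Definition mismatch (K : finType) (a : X -> K) (C : set X) (P : pred K) : set X :=
  [set x | `[< C x >] != P (a x)].

Lemma measurable_mismatch (K : finType) (a : X -> K) C P :
  label a -> measurable C -> measurable (mismatch a C P).
Proof.
move=> la mC.
have := label_pair la (label_mem mC).
by move/(measurable_label [set y | y.2 != P y.1]).
Qed.

Section step.
Variables (L : finType) (b : X -> L) (C : set X).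
Hypotheses (lb : label b) (mC : measurable C).
Let cell l := b @^-1` [set l].
Let mcell l : measurable (cell l). Proof. exact: lb. Qed.

Let pr_cell l : pr (cell l) = pr (cell l `&` C) + pr (cell l `\` C).
Proof. exact: pr_split. Qed.

Let ent_refine : ent (fun x => (b x, `[< C x >])) =
  \sum_l (eta (pr (cell l `&` C)) + eta (pr (cell l `\` C))).
Proof.
rewrite /ent; transitivity (\sum_l \sum_s
    eta (pr ((fun x => (b x, `[< C x >])) @^-1` [set (l, s)]))).
  by rewrite pair_bigA; apply: eq_bigr => -[l s].
apply: eq_bigr => l _; rewrite big_bool; congr (eta (pr _) + eta (pr _)).
- by apply/seteqP; split=> x /=; [move=> [bl /asboolP]|move=> [<- /asboolP ->]].
- apply/seteqP; split=> x /=; first by move=> [bl /negbT/asboolPn].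
  by move=> [<- /asboolPn/negbTE ->].
Qed.

Let pr_mismatch P : pr (mismatch b C P) =
  \sum_l (if P l then pr (cell l `\` C) else pr (cell l `&` C)).
Proof.
rewrite (pr_label mu lb); last exact: measurable_mismatch.
apply: eq_bigr => l _; rewrite -[RHS]fun_if; congr (pr _).
rewrite /mismatch /cell; case Pl: (P l); apply/seteqP; split=> x /= [].
- by move=> + bx; rewrite bx Pl; case: asboolP.
- by move=> bx Cx; rewrite bx Pl; split=> //; case: asboolP.
- by move=> + bx; rewrite bx Pl; case: asboolP.
- by move=> bx Cx; rewrite bx Pl; split=> //; case: asboolP.
Qed.

(** The best approximation of [C] by cells takes a majority vote in each cell, and its error is the
    sum of the minority parts. *)
Lemma mismatch_min (e : R) : (forall P, e <= pr (mismatch b C P)) ->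
  e <= \sum_l Num.min (pr (b @^-1` [set l] `&` C)) (pr (b @^-1` [set l] `\` C)).
Proof.
move=> /(_ (fun l => pr (cell l `\` C) <= pr (cell l `&` C))).
rewrite pr_mismatch => /le_trans; apply; apply: ler_sum => l _.
by rewrite le_min; case: ifP => le1; rewrite lexx ?le1 ?andbT//; lra.
Qed.

Lemma ent_refine_ge (e : R) : (forall P, e <= pr (mismatch b C P)) ->
  ent b + ln 2 * e <= ent (fun x => (b x, `[< C x >])).
Proof.
move=> /mismatch_min He; rewrite ent_refine -lerBrDl /ent -sumrB.
have ln2 : 0 < ln 2 :> R by rewrite ln_gt0// ltr1n.
rewrite -(ler_pM2l ln2) in He; apply: le_trans He _.
rewrite mulr_sumr; apply: ler_sum => l _.
rewrite pr_cell; exact: eta_gap_ge (pr_ge0 _ _) (pr_ge0 _ _).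
Qed.

(** [eta_gap_le] is applied in each cell, with weight [1 - t] on the part where [C] agrees with [P]
    and weight [t] on the mismatch. *)
Lemma ent_refine_le t P : 0 < t < 1 ->
  ent (fun x => (b x, `[< C x >])) <=
  ent b - ln (1 - t) - ln t * pr (mismatch b C P).
Proof.
move=> t01; rewrite pr_mismatch ent_refine -addrA -lerBlDl /ent -sumrB.
have -> : - ln (1 - t) = - ln (1 - t) * \sum_l pr (cell l).
  rewrite (_ : \sum_l pr (cell l) = pr [set: X]) ?pr_setT ?mulr1//.
  by rewrite -(pr_setT mu) (pr_label mu lb measurableT); apply: eq_bigr => l _; rewrite setTI.
rewrite !mulr_sumr -sumrB; apply: ler_sum => l _.
rewrite pr_cell; case: ifP => _.
  have := eta_gap_le (pr_ge0 mu (cell l `&` C)) (pr_ge0 mu (cell l `\` C)) t01.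
  have : ln (1 - t) <= 0 by rewrite ln_le0; lra.
  have := pr_ge0 mu (cell l `\` C); nra.
have := eta_gap_le (pr_ge0 mu (cell l `\` C)) (pr_ge0 mu (cell l `&` C)) t01.
rewrite [pr (cell l `\` C) + _]addrC.
have : ln (1 - t) <= 0 by rewrite ln_le0; lra.
have := pr_ge0 mu (cell l `&` C); nra.
Qed.

End step.

Definition name (C : (set X)^nat) (n : nat) (x : X) : {ffun 'I_n -> bool} :=
  [ffun i : 'I_n => `[< C i x >]].

Lemma name_cell C n (s : {ffun 'I_n -> bool}) :
  name C n @^-1` [set s] = \bigcap_i (if s i then C i else ~` C i).
Proof.
apply/seteqP; split=> x /=.
  by move=> <- i _; rewrite /name ffunE; case: asboolP.
move=> H; apply/ffunP => i; rewrite /name ffunE; have := H i I.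
by case: (s i) => /=; case: asboolP.
Qed.

Lemma label_name C n : (forall i, measurable (C i)) -> label (name C n).
Proof.
move=> mC s; rewrite name_cell.
apply: fin_bigcap_measurable => [|i _]; first exact: finite_finset.
case: ifP => _ //; exact: measurableC.
Qed.

Lemma partition_entropy_join C n :
  partition_entropy mu (join C n) = ent (name C n) / ln 2.
Proof.
rewrite /partition_entropy /join.
pose cell s := name C n @^-1` [set s].
under [X in range X]eq_fun do rewrite -name_cell.
rewrite -/cell.
(* Several sign vectors may give the empty cell, which contributes 0. On nonempty cells the sign
   vector is unique, which allows reindexing. *)
have -> : \sum_(A \in range cell) fine (mu A) * (ln (fine (mu A)) / ln 2) =
    \sum_(A \in cell @` [set s | cell s !=set0]) fine (mu A) * (ln (fine (mu A)) / ln 2).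
  apply/esym/fsbig_widen; first exact: image_subset.
  move=> A [[s _ <-] /= nA]; have -> : cell s = set0.
    by apply/eqP/negPn/negP => /set0P s0; apply: nA; exists s.
  by rewrite measure0 mul0r.
rewrite (@reindex_fsbig _ _ _ _ _ cell [set s | cell s !=set0]); last first.
  split=> [s s0||//]; first by exists s.
  by move=> s t /set_mem[x sx] _ st; rewrite -(sx : _ = s); have : cell t x by rewrite -st.
rewrite (@fsbig_widen _ _ _ _ _ [set: {ffun 'I_n -> bool}])//; last first.
  move=> s [_ /= ns]; have -> : cell s = set0.
    by apply/eqP/negPn/negP => /set0P s0; apply: ns.
  by rewrite measure0 mul0r.
rewrite (fsbigE (index_enum {ffun 'I_n -> bool})) ?index_enum_uniq//; last first.
  by move=> s _; rewrite mem_index_enum.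
rewrite /ent mulr_suml -sumrN; apply: eq_big => s; first by rewrite in_setT.
by move=> _; rewrite /eta /pr mulNr mulrA.
Qed.

End entropy_of_labels.

(** * Bounds for limits inferior and superior from eventual or frequent bounds *)

Section limits_inferior.
Context (R : realType).
Implicit Types (u : (\bar R)^nat) (l : \bar R).
Local Open Scope ereal_scope.

Lemma limn_einf_ge u l m :
  (forall n, (m <= n)%N -> l <= u n) -> l <= limn_einf u.
Proof.
move=> lu; rewrite limn_einf_lim.
apply: lime_ge; first exact: is_cvg_einfs.
exists m => // n /= mn; apply: le_ereal_inf_tmp => _ [k /= nk <-].
by apply: lu; exact: leq_trans nk.
Qed.

Lemma limn_einf_le u l :
  (forall m, exists2 n, (m <= n)%N & u n <= l) -> limn_einf u <= l.
Proof.
move=> ul; rewrite limn_einf_lim.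
apply: lime_le; first exact: is_cvg_einfs.
apply: nearW => m; have [n mn unl] := ul m.
by apply: le_trans unl; apply: ereal_inf_lbound; exists n.
Qed.

Lemma limn_esup_ge u l :
  (forall m, exists2 n, (m <= n)%N & l <= u n) -> l <= limn_esup u.
Proof.
move=> ul; rewrite limn_esup_lim.
apply: lime_ge; first exact: is_cvg_esups.
apply: nearW => m; have [n mn unl] := ul m.
by apply: le_trans unl _; apply: ereal_sup_ubound; exists n.
Qed.

End limits_inferior.

(** * Zero entropy and finite approximation *)

Section approximable.
Context d (X : measurableType d) (R : realType) (mu : probability X R).
Local Notation pr := (pr mu).
Local Notation ent := (ent mu).

Definition approximable (F : set (set X)) := forall e : R, 0 < e ->
  exists (K : finType) (a : X -> K), label a /\
    forall C, F C -> exists P, pr (mismatch a C P) < e.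

Lemma not_approximable F : ~ approximable F ->
  exists2 e : R, 0 < e & forall (K : finType) (a : X -> K), label a ->
    exists2 C, F C & forall P, e <= pr (mismatch a C P).
Proof.
move=> /existsNP[e /not_implyP[e0 /forallNP He]]; exists e => // K a la.
have /forallNP/(_ a)/not_andP[//|/existsNP[C /not_implyP[FC HC]]] := He K.
by exists C => // P; rewrite leNgt; apply/negP => PC; apply: HC; exists P.
Qed.

Variables (F : set (set X)) (F_measurable : forall C, F C -> measurable C).

(** Each [C n] is chosen far from every union of cells of the partition generated by its
    predecessors, so [ent_refine_ge] gives a gain of [ln 2 * e] at each step. *)
Lemma entropy_growth (e : R) :
  (forall (K : finType) (a : X -> K), label a ->
    exists2 C, F C & forall P, e <= pr (mismatch a C P)) ->
  exists2 C : (set X)^nat, (forall n, F (C n)) &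
    forall n, n%:R * (ln 2 * e) <= ent (name C n).
Proof.
move=> He.
(* Measurability of the current name is a premise inside the choice, which makes [pick] total.
   Otherwise any member of [F] serves; the trivial partition provides one. *)
have /choice[pick Hpick] (p : nat * (set X)^nat) : exists D, F D /\
    (label (name p.2 p.1) -> forall P, e <= pr (mismatch (name p.2 p.1) D P)).
  have [lp|nlp] := pselect (label (name p.2 p.1)).
    by have [D FD HD] := He _ _ lp; exists D.
  have [|D FD _] := He unit (fun=> tt); last by exists D.
  move=> [/=]; rewrite (_ : _ @^-1` _ = setT)//.
  by apply/seteqP; split => // x _ /=; case: (_ x).
(* Course-of-values recursion: [st n] agrees with the final sequence [C] below [n], and its later
   entries do not affect [name (st n) n]. *)
pose fix st n : (set X)^nat := if n is m.+1 then
  (fun i => if (i < m)%N then st m i else pick (m, st m)) else (fun=> pick (0%N, fun=> set0)).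
pose C n := pick (n, st n).
have stE n i : (i < n)%N -> st n i = C i.
  elim: n => // n IH; rewrite ltnS leq_eqVlt => /predU1P[->|ni] /=.
    by rewrite ltnn.
  by rewrite ni IH.
have FC n : F (C n) by have [] := Hpick (n, st n).
have mC n : measurable (C n) by exact: F_measurable.
have nameE n : name (st n) n = name C n.
  by apply/funext => x; apply/ffunP => i; rewrite !ffunE stE.
exists C => //; elim => [|n IH].
  rewrite mul0r; apply: sumr_ge0 => s _; apply: eta_ge0.
  by rewrite pr_ge0 pr_le1//; exact: label_name.
have ln_ : label (name C n) by exact: label_name.
have Hn P : e <= pr (mismatch (name C n) (C n) P).
  by have [_] := Hpick (n, st n); rewrite /= nameE; exact.
rewrite -natr1 mulrDl mul1r; apply: le_trans (_ : ent (name C n) + ln 2 * e <= _).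
  by rewrite lerD2r.
apply: le_trans (ent_refine_ge ln_ (mC n) Hn) _.
pose g (s : {ffun 'I_n.+1 -> bool}) :=
  ([ffun i : 'I_n => s (widen_ord (leqnSn n) i)], s ord_max).
rewrite [X in ent X](_ : _ = g \o name C n.+1); first exact/ent_comp/label_name.
apply/funext => x; rewrite /g /= ffunE; congr (_, _).
by apply/ffunP => i; rewrite !ffunE.
Qed.

Lemma approximable_of_entropy0 : (family_entropy mu F <= 0)%E -> approximable F.
Proof.
move=> F0; apply: contrapT => /not_approximable[e e0 /entropy_growth[C FC HC]].
have : (e%:E <= sequence_entropy mu C)%E.
  (* The index 0 is excluded, since [0^-1 = 0] makes that term vanish. *)
  apply: (@limn_einf_ge _ _ _ 1) => n n0.
  rewrite lee_fin partition_entropy_join mulrA ler_pdivlMr ?ln_gt0 ?ltr1n//.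
  by rewrite ler_pdivlMl ?ltr0n// [e * _]mulrC.
have : (sequence_entropy mu C <= family_entropy mu F)%E.
  by apply: ereal_sup_ubound; exists C.
move=> /le_trans/(_ F0)/[swap] /le_trans/[apply].
by rewrite lee_fin leNgt e0.
Qed.

(** The names are refined by an approximating partition [a]. Every further set is almost determined
    by [a], so it adds little entropy, and the initial entropy of [a] disappears after division by
    [n]. *)
Lemma entropy_le0_of_approximable : approximable F -> (family_entropy mu F <= 0)%E.
Proof.
move=> appF; apply: ge_ereal_sup => _ [C FC <-].
have mC n : measurable (C n) by exact/F_measurable/FC.
apply/lee_addgt0Pr => k k0; rewrite add0e.
have ln2 : 0 < ln 2 :> R by rewrite ln_gt0// ltr1n.
(* Each refinement costs at most [2 * c], and the initial entropy is at most [n * (2 * c)] for large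
   [n]; the total rate [4 * c / ln 2] is [k]. *)
pose c : R := k * ln 2 / 4.
have c0 : 0 < c by rewrite !divr_gt0// mulr_gt0.
(* With this [t], the term [- ln (1 - t)] is exactly [c]; the tolerance [c / - ln t] then bounds the
   mismatch term by [c] too. *)
pose t : R := 1 - expR (- c).
have t01 : 0 < t < 1.
  by rewrite subr_gt0 expR_lt1 oppr_lt0 c0 gtrBl expR_gt0.
have lt1 : ln (1 - t) = - c by rewrite /t subKr expRK.
have lnt : ln t < 0 by rewrite ln_lt0.
have [|K [a [la Ha]]] := appF (c / - ln t); first by rewrite divr_gt0// oppr_gt0.
pose b n x := (a x, name C n x).
have lb n : label (b n) by apply: label_pair => //; exact: label_name.
have step n : ent (b n.+1) <= ent (b n) + 2 * c.
  have [P HP] := Ha _ (FC n).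
  have := ent_refine_le mu (lb n) (mC n) (fun p => P p.1) t01.
  rewrite lt1 -[mismatch _ _ _]/(mismatch a (C n) P) => H1.
  have H2 : - ln t * pr (mismatch a (C n) P) <= c.
    by rewrite mulrC -ler_pdivlMr ?oppr_gt0// ltW.
  pose g (p : K * {ffun 'I_n -> bool} * bool) : K * {ffun 'I_n.+1 -> bool} :=
    (p.1.1, [ffun i => if unlift ord_max i is Some j then p.1.2 j else p.2]).
  have : ent (b n.+1) <= ent (fun x => (b n x, `[< C n x >])).
    rewrite [X in ent X <= _](_ : _ = g \o (fun x => (b n x, `[< C n x >]))).
      by apply: ent_comp; apply: label_pair => //; exact: label_mem.
    apply/funext => x; rewrite /g /b /=; congr (_, _); apply/ffunP => i.
    rewrite !ffunE; case: unliftP => [j ->|->]; last by [].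
    by rewrite ffunE lift_max.
  by lra.
have Hb n : ent (b n) <= ent (b 0%N) + n%:R * (2 * c).
  elim: n => [|n IH]; first by rewrite mul0r addr0.
  by apply: le_trans (step n) _; rewrite -natr1; lra.
apply: limn_einf_le => m.
pose n := (m + `|Num.ceil (ent (b 0%N) / (2 * c))|%N).+1.
exists n; first by rewrite ltnW// ltnS leq_addr.
have n0 : 0 < n%:R :> R by rewrite ltr0n.
rewrite lee_fin partition_entropy_join mulrA ler_pdivrMr// ler_pdivrMl//.
have : ent (name C n) <= ent (b n).
  rewrite [X in ent X <= _](_ : _ = snd \o b n); last exact/funext.
  exact: ent_comp.
have : ent (b 0%N) <= n%:R * (2 * c).
  rewrite -ler_pdivrMr ?mulr_gt0//; apply: le_trans (ceil_ge _) _.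
  have -> : n%:R = m%:R + `|Num.ceil (ent (b 0%N) / (2 * c))|%N%:R + 1 :> R.
    by rewrite -natrD natr1.
  rewrite natr_absz intr_norm.
  have := ler0n R m; have := ler_norm ((Num.ceil (ent (b 0%N) / (2 * c)))%:~R : R). lra.
have := Hb n; rewrite /c; lra.
Qed.

End approximable.

(** * Uniform mixing *)

Section mixing_estimates.
Context d (X : measurableType d) (R : realType) (mu : probability X R).
Variable T : X -> X.
Hypotheses (T_mp : measure_preserving mu T) (T_mixing : strong_mixing mu T).
Local Notation pr := (pr mu).

Lemma measure_preserving_iter n : measure_preserving mu (iter n T).
Proof.
have [mT muT] := T_mp; elim: n => [|n [mTn muTn]].
  by split=> [|A mA]; [exact: measurable_id|].
split; first exact: measurableT_comp.
move=> A mA /=; rewrite -[RHS]muT// -[RHS]muTn//.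
by rewrite -[X in measurable X]setTI; exact: mT.
Qed.

Lemma measurable_preim n A : measurable A -> measurable (iter n T @^-1` A).
Proof.
by have [mTn _] := measure_preserving_iter n => mA;
  rewrite -[X in measurable X]setTI; exact: mTn.
Qed.

Lemma pr_preim n A : measurable A -> pr (iter n T @^-1` A) = pr A.
Proof.
by move=> mA; rewrite /pr (measure_preserving_iter n).2.
Qed.

Definition gap n A B : R := pr (A `&` iter n T @^-1` B) - pr A * pr B.

Lemma mixing_gapE n A B : measurable A -> measurable B ->
  mixing_gap mu T n A B = `|gap n A B|%:E.
Proof.
move=> mA mB; rewrite /mixing_gap !(prE mu)//.
by apply: measurableI => //; exact: measurable_preim.
Qed.

Lemma gap_small A B (e : R) : measurable A -> measurable B -> 0 < e ->
  exists N, forall n, (N <= n)%N -> `|gap n A B| < e.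
Proof.
move=> mA mB e0; have := T_mixing mA mB.
under eq_fun do rewrite mixing_gapE//.
move=> /fine_cvgP[_ /cvgrPdist_lt/(_ _ e0)] [N _ HN]; exists N => n Nn.
by have := HN n Nn; rewrite /= sub0r normrN normr_id.
Qed.

Lemma gap_small_fin (I : finType) (A B : I -> set X) (e : R) :
  (forall i, measurable (A i)) -> (forall i, measurable (B i)) -> 0 < e ->
  exists N, forall n, (N <= n)%N -> forall i, `|gap n (A i) (B i)| < e.
Proof.
move=> mA mB e0; have /choice[N HN] i := gap_small (mA i) (mB i) e0.
exists (\max_i N i)%N => n Nn i; apply: HN; apply: leq_trans Nn.
exact: leq_bigmax.
Qed.

(** The inclusions say that [M] and [M'] contain the symmetric differences. The measure of the
    intersection and the product of the measures each change by at most [pr M + pr M']. *)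
Lemma gap_perturb n A B A' B' M M' : measurable A -> measurable B ->
  measurable A' -> measurable B' -> measurable M -> measurable M' ->
  A `<=` A' `|` M -> A' `<=` A `|` M -> B `<=` B' `|` M' -> B' `<=` B `|` M' ->
  `|gap n A B| <= `|gap n A' B'| + 2 * (pr M + pr M').
Proof.
have half A1 B1 A2 B2 M1 M2 : measurable A1 -> measurable B1 ->
    measurable A2 -> measurable B2 -> measurable M1 -> measurable M2 ->
    A1 `<=` A2 `|` M1 -> B1 `<=` B2 `|` M2 ->
    pr (A1 `&` iter n T @^-1` B1) <= pr (A2 `&` iter n T @^-1` B2) + (pr M1 + pr M2).
  move=> mA1 mB1 mA2 mB2 mM1 mM2 A12 B12.
  rewrite -(pr_preim n mM2).
  have mI C D : measurable C -> measurable D -> measurable (C `&` iter n T @^-1` D).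
    by move=> mC mD; apply: measurableI => //; exact: measurable_preim.
  apply: le_trans (_ : _ <= pr (A2 `&` iter n T @^-1` B2) + pr (M1 `|` iter n T @^-1` M2)) _.
    apply: pr_leU; [exact: mI|exact: mI|by apply: measurableU => //; exact: measurable_preim|].
    move=> x [/A12 + /B12]; rewrite /setU /setI /preimage/=; tauto.
  rewrite lerD2l; apply: pr_leU => //; last exact: measurable_preim.
  by apply: measurableU => //; exact: measurable_preim.
move=> mA mB mA' mB' mM mM' AA' A'A BB' B'B.
have := half A B A' B' M M' mA mB mA' mB' mM mM' AA' BB'.
have := half A' B' A B M M' mA' mB' mA mB mM mM' A'A B'B.
have := pr_leU mu mA mA' mM AA'; have := pr_leU mu mA' mA mM A'A.
have := pr_leU mu mB mB' mM' BB'; have := pr_leU mu mB' mB mM' B'B.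
have := pr_ge0 mu A; have := pr_ge0 mu B'.
have := pr_le1 mu mA; have := pr_le1 mu mB'.
rewrite /gap; set a := pr A; set b := pr B; set a' := pr A'; set b' := pr B'.
set q := pr (A `&` _); set q' := pr (A' `&` _); set m := pr M; set m' := pr M'.
move=> b'1 a1 b'0 a0 h1 h2 h3 h4 h5 h6.
have h7 : a * (b - b') <= m' by have := pr_ge0 mu M'; rewrite -/m'; nra.
have h8 : a * (b' - b) <= m' by have := pr_ge0 mu M'; rewrite -/m'; nra.
have h9 : (a - a') * b' <= m by have := pr_ge0 mu M; rewrite -/m; nra.
have h10 : (a' - a) * b' <= m by have := pr_ge0 mu M; rewrite -/m; nra.
rewrite ler_norml; have := ler_norm (q' - a' * b').
have := ler_norm (- (q' - a' * b')); rewrite normrN => n1 n2.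
apply/andP; split; lra.
Qed.

Lemma uniform_mixing (F : set (set X)) (e : R) :
  (forall A, F A -> measurable A) -> approximable mu F -> 0 < e ->
  exists N, forall n, (N <= n)%N -> forall A B, F A -> F B -> `|gap n A B| < e.
Proof.
(* Replacing both sets by unions of cells costs [2 * (e / 8 + e / 8)], and the finitely many pairs
   of unions have gap below [e / 4]; the sum is less than [e]. *)
move=> mF appF e0; have e8 : 0 < e / 8 by lra.
have [K [a [la Ha]]] := appF _ e8.
pose cell (s : {ffun K -> bool}) := a @^-1` [set k | s k].
have mcell s : measurable (cell s) by exact: measurable_label.
have [|N HN] := @gap_small_fin ({ffun K -> bool} * {ffun K -> bool})%type
    (fun s => cell s.1) (fun s => cell s.2) (e / 4) (fun=> mcell _) (fun=> mcell _).
  by lra.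
exists N => n Nn A B FA FB.
have [P HP] := Ha _ FA; have [Q HQ] := Ha _ FB.
have := HN n Nn ([ffun k => P k], [ffun k => Q k]) => /=.
have sub C (D : pred K) : C `<=` cell [ffun k => D k] `|` mismatch a C D /\
    cell [ffun k => D k] `<=` C `|` mismatch a C D.
  rewrite /cell /mismatch; split=> x; rewrite /setU /preimage/= ffunE.
    by move=> Cx; case: (D (a x)); [left|right; case: asboolP].
  by move=> ->; case: (asboolP (C x)) => Cx; [left|right].
have := @gap_perturb n A B (cell [ffun k => P k]) (cell [ffun k => Q k])
  (mismatch a A P) (mismatch a B Q) (mF _ FA) (mF _ FB) (mcell _) (mcell _)
  (measurable_mismatch _ la (mF _ FA)) (measurable_mismatch _ la (mF _ FB))
  (sub _ _).1 (sub _ _).2 (sub _ _).1 (sub _ _).2.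
lra.
Qed.

Lemma cvg_sup_mixing_gap (F : set (set X)) :
  (forall A, F A -> measurable A) -> F !=set0 -> approximable mu F ->
  (ereal_sup [set mixing_gap mu T n A B | A in F & B in F] @[n --> \oo] --> 0)%E.
Proof.
move=> mF [C FC] appF.
(* A member of [F] is required here: the supremum over an empty family is [-oo]. *)
have ge0 n : (0 <= ereal_sup [set mixing_gap mu T n A B | A in F & B in F])%E.
  apply: le_trans (_ : mixing_gap mu T n C C <= _)%E; first exact: abse_ge0.
  by apply: ereal_sup_ubound; exists C => //; exists C.
have le n (e : R) : (forall A B, F A -> F B -> `|gap n A B| < e) ->
    (ereal_sup [set mixing_gap mu T n A B | A in F & B in F] <= e%:E)%E.
  move=> H; apply: ge_ereal_sup => _ [A FA [B FB <-]].
  rewrite mixing_gapE; [|exact: mF..].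
  by rewrite lee_fin ltW// H.
apply/fine_cvgP; split.
  have [N HN] := uniform_mixing mF appF ltr01.
  exists N => // n Nn; rewrite ge0_fin_numE//.
  by apply: le_lt_trans (le n _ (HN n Nn)) _; rewrite ltry.
apply/cvgrPdist_lt => e e0; have e2 : 0 < e / 2 by lra.
have [N HN] := uniform_mixing mF appF e2; exists N => // n Nn /=.
rewrite sub0r normrN ger0_norm ?fine_ge0//.
have := le n _ (HN n Nn).
move=> h; apply: (@le_lt_trans _ _ (e / 2)); last by lra.
rewrite -lee_fin fineK// ge0_fin_numE//.
by apply: le_lt_trans h _; rewrite ltry.
Qed.

End mixing_estimates.

(** * Automorphisms and the exchange lemma *)

Section automorphism_group.
Context d (X : measurableType d) (R : realType) (mu : probability X R).
Implicit Types phi psi : inv_mpt mu.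
Local Notation pr := (pr mu).

Lemma imt_measurable phi A : measurable A -> measurable (phi @^-1` A).
Proof.
by move=> mA; rewrite -[X in measurable X]setTI;
  exact: (imt_measure_preserving phi).1.
Qed.

Lemma imt_inv_preim_measurable phi A :
  measurable A -> measurable (imt_inv phi @^-1` A).
Proof.
by move=> mA; rewrite -[X in measurable X]setTI; exact: imt_inv_measurable.
Qed.

Lemma imt_measure phi A : measurable A -> mu (phi @^-1` A) = mu A.
Proof. exact: (imt_measure_preserving phi).2. Qed.

Lemma imt_inv_measure phi A : measurable A -> mu (imt_inv phi @^-1` A) = mu A.
Proof.
move=> mA; rewrite -(imt_measure phi); last exact: imt_inv_preim_measurable.
by congr (mu _); apply/seteqP; split=> x; rewrite /preimage/= imt_funK.
Qed.

Lemma pr_imt phi A : measurable A -> pr (phi @^-1` A) = pr A.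
Proof. by move=> mA; rewrite /pr imt_measure. Qed.

Lemma pr_imt_inv phi A : measurable A -> pr (imt_inv phi @^-1` A) = pr A.
Proof. by move=> mA; rewrite /pr imt_inv_measure. Qed.

Lemma imt_inv_measure_preserving phi : measure_preserving mu (imt_inv phi).
Proof. by split; [exact: imt_inv_measurable|exact: imt_inv_measure]. Qed.

Lemma imt_comp_measure_preserving phi psi : measure_preserving mu (phi \o psi).
Proof.
split=> [|A mA].
  by apply: measurableT_comp;
    [exact: (imt_measure_preserving phi).1|exact: (imt_measure_preserving psi).1].
by rewrite comp_preimage imt_measure ?imt_measure//; exact: imt_measurable.
Qed.

Lemma imt_comp_inv_measurable phi psi :
  measurable_fun [set: X] (imt_inv psi \o imt_inv phi).
Proof. by apply: measurableT_comp; exact: imt_inv_measurable. Qed.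

Definition imt_sym phi : inv_mpt mu :=
  InvMpt (imt_inv_measure_preserving phi) (imt_measure_preserving phi).1
    (@imt_invK _ _ _ _ phi) (@imt_funK _ _ _ _ phi).

Definition imt_comp phi psi : inv_mpt mu :=
  InvMpt (imt_comp_measure_preserving phi psi) (imt_comp_inv_measurable phi psi)
    (can_comp (@imt_funK _ _ _ _ phi) (@imt_funK _ _ _ _ psi))
    (can_comp (@imt_invK _ _ _ _ psi) (@imt_invK _ _ _ _ phi)).

Lemma iterK (f g : X -> X) n : cancel f g -> cancel (iter n f) (iter n g).
Proof. by move=> fK; elim: n => // n IH x; rewrite iterSr iterS fK IH. Qed.

Definition imt_iter phi n : inv_mpt mu :=
  InvMpt (measure_preserving_iter (imt_measure_preserving phi) n)
    (measure_preserving_iter (imt_inv_measure_preserving phi) n).1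
    (iterK n (@imt_funK _ _ _ _ phi)) (iterK n (@imt_invK _ _ _ _ phi)).

(** Countable additivity over the pieces [Z k] and their complement, where [f] is the identity. *)
Lemma imt_preserving_piecewise (f : X -> X) (Z : (set X)^nat) :
  measurable_fun [set: X] f -> (forall k, measurable (Z k)) -> trivIset setT Z ->
  (forall x, ~ (\bigcup_k Z k) x -> f x = x) ->
  (forall x, (\bigcup_k Z k) x -> (\bigcup_k Z k) (f x)) ->
  (forall k A, measurable A -> mu (f @^-1` A `&` Z k) = mu (A `&` Z k)) ->
  measure_preserving mu f.
Proof.
move=> mf mZ tZ fid fZ muZ; split=> // A mA.
have mfA : measurable (f @^-1` A) by rewrite -[X in measurable X]setTI; exact: mf.
have mU : measurable (\bigcup_k Z k) by exact: bigcupT_measurable.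
have split_ B : measurable B ->
    mu B = (mu (B `\` \bigcup_k Z k) +
            \sum_(0 <= k <oo | k \in [set: nat]) mu (B `&` Z k))%E.
  move=> mB; rewrite (measureDI mu mB mU) setI_bigcupr; congr (_ + _)%E.
  apply: measure_bigcup => [k _|]; first exact: measurableI.
  exact: trivIset_setIl.
rewrite split_// [RHS]split_//; congr (_ + _)%E.
  congr (mu _); apply/seteqP; split=> x [Ax nZ]; split=> //.
    by rewrite -(fid x nZ).
  by rewrite /preimage/= fid.
by apply: eq_eseriesr => k _; rewrite muZ.
Qed.

End automorphism_group.

(** * Exchanging two sets by powers of a mixing automorphism *)

Section exchange.
Context d (X : measurableType d) (R : realType) (mu : probability X R).
Variable T : inv_mpt mu.
Hypothesis T_mixing : strong_mixing mu T.
Local Notation pr := (pr mu).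
Variables (L : finType) (c : X -> L) (lc : label c).
Variables (Y1 Y2 : set X) (mY1 : measurable Y1) (mY2 : measurable Y2).
Hypothesis Y12 : forall x, Y1 x -> ~ Y2 x.

Let t k : X -> X := iter k T.
Let s k : X -> X := iter k (imt_inv T).

Let stK k : cancel (t k) (s k). Proof. exact: (imt_funK (imt_iter T k)). Qed.
Let tsK k : cancel (s k) (t k). Proof. exact: (imt_invK (imt_iter T k)). Qed.

(* Greedy exchange: at step [k], a point [x] still free in [Y1] is matched with
   [T^k x] whenever the latter is still free in [Y2] and has the same label. *)
Fixpoint unmatched k : set X * set X :=
  if k is j.+1 then
    ([set x | (unmatched j).1 x /\ ~ ((unmatched j).2 (t j x) /\ c (t j x) = c x)],
     [set y | (unmatched j).2 y /\ ~ ((unmatched j).1 (s j y) /\ c (s j y) = c y)])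
  else (Y1, Y2).

(** Sources [M k] and targets [N k] of the pairs formed at step [k]; [t k] and [s k] are inverse
    bijections between them. *)
Let M k : set X :=
  [set x | [/\ (unmatched k).1 x, (unmatched k).2 (t k x) & c (t k x) = c x]].
Let N k : set X :=
  [set y | [/\ (unmatched k).2 y, (unmatched k).1 (s k y) & c (s k y) = c y]].

Let MN k x : M k x -> N k (t k x).
Proof. by move=> [h1 h2 h3]; split; rewrite ?stK. Qed.

Let NM k x : N k x -> M k (s k x).
Proof. by move=> [h1 h2 h3]; split; rewrite ?tsK. Qed.

Let unmatched_sub k j x : (k <= j)%N ->
  ((unmatched j).1 x -> (unmatched k).1 x) /\
  ((unmatched j).2 x -> (unmatched k).2 x).
Proof.
move=> /subnK <-; elim: (j - k)%N => // n [IH1 IH2] /=.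
by split=> -[H _]; [exact: IH1|exact: IH2].
Qed.

Let M_inj k j x : M k x -> M j x -> k = j.
Proof.
wlog kj : k j / (k < j)%N.
  move=> H Mk Mj; case: (ltngtP k j) => // lt; first exact: H.
  by apply/esym; exact: H.
move=> [_ h2 h3] [h _ _]; have [_ nh] := (unmatched_sub x kj).1 h.
by case: nh.
Qed.

Let N_inj k j x : N k x -> N j x -> k = j.
Proof.
wlog kj : k j / (k < j)%N.
  move=> H Mk Mj; case: (ltngtP k j) => // lt; first exact: H.
  by apply/esym; exact: H.
move=> [_ h2 h3] [h _ _]; have [_ nh] := (unmatched_sub x kj).2 h.
by case: nh.
Qed.

Let MY1 k x : M k x -> Y1 x.
Proof. by move=> [h _ _]; exact: (unmatched_sub x (leq0n k)).1 h. Qed.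

Let NY2 k x : N k x -> Y2 x.
Proof. by move=> [h _ _]; exact: (unmatched_sub x (leq0n k)).2 h. Qed.

Let swap x : X :=
  match pselect (exists k, M k x) with
  | left H => t (projT1 (cid H)) x
  | right _ => match pselect (exists k, N k x) with
    | left H => s (projT1 (cid H)) x
    | right _ => x
    end
  end.

Let swapM k x : M k x -> swap x = t k x.
Proof.
move=> Mx; rewrite /swap; case: pselect => [H|[]]; last by exists k.
by case: cid => j /= Mj; rewrite (M_inj Mx Mj).
Qed.

Let swapN k x : N k x -> swap x = s k x.
Proof.
move=> Nx; rewrite /swap; case: pselect => [[j Mj]|_].
  by case: (Y12 (MY1 Mj) (NY2 Nx)).
case: pselect => [H|[]]; last by exists k.
by case: cid => j /= Mj; rewrite (N_inj Nx Mj).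
Qed.

Let W1 := \bigcup_k M k.
Let W2 := \bigcup_k N k.

Let swap_id x : ~ W1 x -> ~ W2 x -> swap x = x.
Proof.
move=> n1 n2; rewrite /swap; case: pselect => [[k Mk]|_].
  by case: n1; exists k.
by case: pselect => // -[k Nk]; case: n2; exists k.
Qed.

Let swapW1 x : W1 x -> W2 (swap x).
Proof. by move=> [k _ Mk]; exists k => //; rewrite (swapM Mk); exact: MN. Qed.

Let swapW2 x : W2 x -> W1 (swap x).
Proof. by move=> [k _ Mk]; exists k => //; rewrite (swapN Mk); exact: NM. Qed.

Let swapK : involutive swap.
Proof.
move=> x; have [[k _ Mk]|n1] := pselect (W1 x).
  by rewrite (swapM Mk) (swapN (MN Mk)) stK.
have [[k _ Nk]|n2] := pselect (W2 x).
  by rewrite (swapN Nk) (swapM (NM Nk)) tsK.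
by rewrite !swap_id.
Qed.

Let swap_label x : c (swap x) = c x.
Proof.
have [[k _ Mk]|n1] := pselect (W1 x); first by rewrite (swapM Mk); case: Mk.
have [[k _ Nk]|n2] := pselect (W2 x); first by rewrite (swapN Nk); case: Nk.
by rewrite swap_id.
Qed.

Let mt k A : measurable A -> measurable (t k @^-1` A).
Proof. exact: (imt_measurable (imt_iter T k)). Qed.

Let ms k A : measurable A -> measurable (s k @^-1` A).
Proof. exact: (imt_inv_preim_measurable (imt_iter T k)). Qed.

Let m_same (f : X -> X) : (forall A, measurable A -> measurable (f @^-1` A)) ->
  measurable [set x | c (f x) = c x].
Proof.
move=> mf; rewrite (_ : mkset _ = (fun x => (c (f x), c x)) @^-1` [set p | p.1 = p.2])//.
apply: measurable_label; apply: label_pair => // l; exact: (mf _ (lc l)).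
Qed.

Let munmatched k : measurable (unmatched k).1 /\ measurable (unmatched k).2.
Proof.
elim: k => //= k [IH1 IH2]; split; apply: measurableI => //; apply: measurableC.
- by apply: measurableI; [exact: mt|exact/m_same/mt].
- by apply: measurableI; [exact: ms|exact/m_same/ms].
Qed.

Let mM k : measurable (M k).
Proof.
have [m1 m2] := munmatched k.
rewrite (_ : M k = (unmatched k).1 `&` (t k @^-1` (unmatched k).2 `&` [set x | c (t k x) = c x])).
  by do 2?[apply: measurableI => //]; [exact: mt|exact/m_same/mt].
by apply/seteqP; split=> x; [move=> [? ? ?]|move=> [? [? ?]]]; split.
Qed.

Let mN k : measurable (N k).
Proof.
have [m1 m2] := munmatched k.
rewrite (_ : N k = (unmatched k).2 `&` (s k @^-1` (unmatched k).1 `&` [set x | c (s k x) = c x])).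
  by do 2?[apply: measurableI => //]; [exact: ms|exact/m_same/ms].
by apply/seteqP; split=> x; [move=> [? ? ?]|move=> [? [? ?]]]; split.
Qed.

Let mW1 : measurable W1. Proof. exact: bigcupT_measurable. Qed.
Let mW2 : measurable W2. Proof. exact: bigcupT_measurable. Qed.

Let swap_preim A : swap @^-1` A =
  \bigcup_k (M k `&` t k @^-1` A) `|` \bigcup_k (N k `&` s k @^-1` A)
  `|` (A `\` (W1 `|` W2)).
Proof.
apply/seteqP; split=> x; rewrite /preimage/=.
  have [[k _ Mk]|n1] := pselect (W1 x).
    by rewrite (swapM Mk) => Ax; left; left; exists k.
  have [[k _ Nk]|n2] := pselect (W2 x).
    by rewrite (swapN Nk) => Ax; left; right; exists k.
  by rewrite swap_id// => Ax; right; split=> // -[].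
case=> [[[k _ [Mk Ax]]|[k _ [Nk Ax]]]|[Ax /not_orP[n1 n2]]].
- by rewrite (swapM Mk).
- by rewrite (swapN Nk).
- by rewrite swap_id.
Qed.

Let swap_measurable : measurable_fun [set: X] swap.
Proof.
move=> _ A mA; rewrite setTI swap_preim; apply: measurableU; last first.
  by apply: measurableD => //; exact: measurableU.
by apply: measurableU; apply: bigcupT_measurable => k; apply: measurableI => //;
  [exact: mt|exact: ms].
Qed.

Let swap_mp : measure_preserving mu swap.
Proof.
(* Each piece is invariant: [swap] is [T^k] on [M k] and [T^-k] on [N k]. *)
apply: (@imt_preserving_piecewise _ _ _ _ _ (fun k => M k `|` N k)) => //.
- by move=> k; exact: measurableU.
- move=> i j _ _ [x [[Mi|Ni] [Mj|Nj]]].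
  + exact: M_inj Mi Mj.
  + by case: (Y12 (MY1 Mi) (NY2 Nj)).
  + by case: (Y12 (MY1 Mj) (NY2 Ni)).
  + exact: N_inj Ni Nj.
- by move=> x nx; apply: swap_id => -[k _ Hk]; apply: nx; exists k => //; [left|right].
- move=> x [k _ [Mk|Nk]]; exists k => //.
    by right; rewrite (swapM Mk); exact: MN.
  by left; rewrite (swapN Nk); exact: NM.
move=> k A mA.
have dMN : M k `&` N k = set0.
  by apply/seteqP; split=> // x [/MY1 h /NY2]; exact: Y12.
have mAM : measurable (A `&` M k) by exact: measurableI.
have mAN : measurable (A `&` N k) by exact: measurableI.
rewrite !setIUr [RHS]measureU//; last by rewrite setIACA dMN setI0.
have -> : swap @^-1` A `&` M k = t k @^-1` (A `&` N k).
  apply/seteqP; split=> x; rewrite /preimage/=.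
    by move=> [Ax Mk]; rewrite (swapM Mk) in Ax; split=> //; exact: MN.
  by move=> [Ax /NM]; rewrite stK => Mk; rewrite (swapM Mk).
have -> : swap @^-1` A `&` N k = s k @^-1` (A `&` M k).
  apply/seteqP; split=> x; rewrite /preimage/=.
    by move=> [Ax Nk]; rewrite (swapN Nk) in Ax; split=> //; exact: NM.
  by move=> [Ax /MN]; rewrite tsK => Nk; rewrite (swapN Nk).
rewrite measureU; [|exact: mt|exact: ms|].
  rewrite addeC; congr (_ + _)%E.
    exact: (imt_inv_measure (imt_iter T k)).
  exact: (imt_measure (imt_iter T k)).
by apply/seteqP; split=> // x [[_ /NM]]; rewrite stK => /MY1 h [_ /MN];
  rewrite tsK => /NY2; exact: Y12.
Qed.

Let swap_imt : inv_mpt mu := InvMpt swap_mp swap_measurable swapK swapK.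

Let unmatched1 x k : Y1 x -> ~ W1 x -> (unmatched k).1 x.
Proof.
move=> Yx nW; elim: k => //= k IH; split=> // -[h1 h2].
by apply: nW; exists k.
Qed.

Let unmatched2 x k : Y2 x -> ~ W2 x -> (unmatched k).2 x.
Proof.
move=> Yx nW; elim: k => //= k IH; split=> // -[h1 h2].
by apply: nW; exists k.
Qed.

(** Let [A] and [B] be the leftovers of [Y1] and [Y2] with label [l]. No [T^k] maps a point of [A]
    into [B], for this pair would have been matched at step [k]. By mixing [pr A * pr B = 0], so one
    side is exhausted; [W1] and [W2] have equal mass on each label. *)
Let min_le l : Num.min (pr (Y1 `&` c @^-1` [set l])) (pr (Y2 `&` c @^-1` [set l]))
  <= pr (W1 `&` c @^-1` [set l]).
Proof.
pose A := (Y1 `\` W1) `&` c @^-1` [set l].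
pose B := (Y2 `\` W2) `&` c @^-1` [set l].
have mcl : measurable (c @^-1` [set l]) by exact: lc.
have mA : measurable A by apply: measurableI => //; exact: measurableD.
have mB : measurable B by apply: measurableI => //; exact: measurableD.
have AB0 k : A `&` t k @^-1` B = set0.
  apply/seteqP; split=> // x [[[Yx nW] cx] [[Y2x nW2] ctx]]; apply: (nW).
  exists k => //; split; last by rewrite ctx.
    exact: unmatched1.
  exact: unmatched2.
have AB : pr A * pr B = 0.
  apply/eqP; rewrite eq_le mulr_ge0 ?pr_ge0// andbT; apply/ler_addgt0Pr => e e0.
  have [k /(_ k (leqnn k))] :=
    gap_small (imt_measure_preserving T) T_mixing mA mB e0.
  rewrite /gap AB0 pr_set0 sub0r normrN add0r => h.
  by apply: le_trans (ltW h); exact: ler_norm.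
have le1 : pr (Y1 `&` c @^-1` [set l]) <= pr (W1 `&` c @^-1` [set l]) + pr A.
  apply: pr_leU => //; [exact: measurableI|exact: measurableI|move=> x [Yx cx]].
  by have [?|?] := pselect (W1 x); [left|right].
have le2 : pr (Y2 `&` c @^-1` [set l]) <= pr (W2 `&` c @^-1` [set l]) + pr B.
  apply: pr_leU => //; [exact: measurableI|exact: measurableI|move=> x [Yx cx]].
  by have [?|?] := pselect (W2 x); [left|right].
have eqW : pr (W2 `&` c @^-1` [set l]) = pr (W1 `&` c @^-1` [set l]).
  rewrite -(pr_imt swap_imt); last exact: measurableI.
  congr (pr _); apply/seteqP; split=> x; rewrite /preimage/= swap_label => -[Wx <-].
    by split=> //; rewrite -(swapK x); exact: swapW2.
  by split=> //; exact: swapW1.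
rewrite ge_min; move/eqP: AB; rewrite mulf_eq0 => /orP[]/eqP E.
  by rewrite E addr0 in le1; rewrite le1.
by rewrite E addr0 eqW in le2; rewrite le2 orbT.
Qed.

Lemma exchange : exists (psi : inv_mpt mu) (V1 V2 : set X),
  [/\ measurable V1 /\ measurable V2, V1 `<=` Y1 /\ V2 `<=` Y2,
      involutive psi,
      [/\ forall x, V1 x -> V2 (psi x), forall x, V2 x -> V1 (psi x),
          forall x, ~ V1 x -> ~ V2 x -> psi x = x &
          forall x, c (psi x) = c x] &
      forall l, Num.min (pr (Y1 `&` c @^-1` [set l])) (pr (Y2 `&` c @^-1` [set l]))
        <= pr (V1 `&` c @^-1` [set l])].
Proof.
exists swap_imt, W1, W2; split=> //; split=> //.
  by move=> x [k _ /MY1].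
by move=> x [k _ /NY2].
Qed.

End exchange.

(** * Perturbing an automorphism against mixing *)

Section second_difference.
Context d (X : measurableType d) (R : realType) (mu : probability X R).
Local Notation pr := (pr mu).
Variables (S psi : inv_mpt mu) (D G W1 W2 : set X).
Hypotheses (mD : measurable D) (mG : measurable G).
Hypotheses (mW1 : measurable W1) (mW2 : measurable W2).
Hypotheses (W1Y : forall x, W1 x -> [/\ G x, D x, ~ G (S x) & D (S x)]).
Hypotheses (W2Y : forall x, W2 x -> [/\ G x, ~ D x, ~ G (S x) & ~ D (S x)]).
Hypotheses (psi1 : forall x, W1 x -> W2 (psi x))
  (psi2 : forall x, W2 x -> W1 (psi x))
  (psi_id : forall x, ~ W1 x -> ~ W2 x -> psi x = x).

(** The conjugate of [psi] by [S] moves only points of the image of [W1] and [W2] under [S]; it acts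
    on the second factor of [1_D(x) 1_D(Sx)] as [psi] acts on the first. *)
Definition conj_psi : inv_mpt mu := imt_comp S (imt_comp psi (imt_sym S)).
Arguments conj_psi : simpl never.

Let q (E : set X) : R := pr (E `&` S @^-1` E).

Let SV x := imt_inv S x.
Let SVK x : SV (S x) = x. Proof. exact: imt_funK. Qed.
Let SSV x : S (SV x) = x. Proof. exact: imt_invK. Qed.

(** [psi] trades [W1], inside [D], for [W2], outside [D]. The two digits in [D10], [D01], [D11] tell
    whether [psi] and its conjugate are applied. *)
Let D10 x : D (psi x) <-> (W2 x \/ D x /\ ~ W1 x).
Proof.
have [w1|n1] := pselect (W1 x).
  have [_ nd _ _] := W2Y (psi1 w1).
  split=> // -[w2|[_ []]//].
  by have [_ dx _ _] := W1Y w1; have [_ []] := W2Y w2.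
have [w2|n2] := pselect (W2 x).
  by have [_ dd _ _] := W1Y (psi2 w2); split=> // _; left.
by rewrite psi_id//; tauto.
Qed.

Let D01 x : D (conj_psi x) <-> (W2 (SV x) \/ D x /\ ~ W1 (SV x)).
Proof.
rewrite /conj_psi /=.
have [w1|n1] := pselect (W1 (SV x)).
  have [_ _ _ nd] := W2Y (psi1 w1).
  split=> // -[w2|[_ []]//].
  by have [_ dx _ _] := W1Y w1; have [_ []] := W2Y w2.
have [w2|n2] := pselect (W2 (SV x)).
  by have [_ _ _ dd] := W1Y (psi2 w2); split=> // _; left.
by rewrite psi_id// SSV; tauto.
Qed.

Let W1C x : W1 (psi x) <-> W2 x.
Proof.
split=> [w|]; last exact: psi2.
apply: contrapT => n2; have [w1|n1] := pselect (W1 x).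
  by have [_ dx _ _] := W1Y w; have [_ nd _ _] := W2Y (psi1 w1).
by apply: (n1); rewrite -(psi_id n1 n2).
Qed.

Let D11 x : D (psi (conj_psi x)) <->
  (W2 x \/ W2 (SV x) \/ D x /\ ~ W1 x /\ ~ W1 (SV x)).
Proof.
(* Points of [W1] and [W2] lie in [G] and their images under [S] do not, so the two modifications
   have disjoint supports. *)
have notboth y : W1 (SV y) \/ W2 (SV y) -> ~ W1 y /\ ~ W2 y.
  have WG z : W1 z \/ W2 z -> G z /\ ~ G (S z) by move=> [/W1Y|/W2Y][].
  by move=> /WG[_]; rewrite SSV => ng; split=> w; apply: ng; apply: (WG y _).1; tauto.
have [w1|n1] := pselect (W1 (SV x)).
  have w2 := psi1 w1; have [_ _ ng nd] := W2Y w2.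
  have [|m1 m2] := notboth (conj_psi x); first by rewrite /conj_psi/= [SV _]SVK; right.
  have [k1 k2] := notboth x (or_introl w1).
  rewrite psi_id//; split=> // -[//|[w2'|[_ [_ []]]//]].
  by have [_ dx _ _] := W1Y w1; have [_ []] := W2Y w2'.
have [w2|n2] := pselect (W2 (SV x)).
  have w1 := psi2 w2; have [_ _ ng nd] := W1Y w1.
  have [|m1 m2] := notboth (conj_psi x); first by rewrite /conj_psi/= [SV _]SVK; left.
  by rewrite psi_id//; split=> // _; right; left.
have -> : conj_psi x = x by rewrite /conj_psi/= psi_id// SSV.
by rewrite D10; tauto.
Qed.

(** Pointwise form of the second difference. The letters [w], [z], [v] stand for membership in [W1]
    and [W2] of [x], its preimage and its image under [S]; [d0] and [d1] for membership in [D] of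
    [x] and [S x]. *)
Let count_ineq (w1 w2 z1 z2 v1 v2 d0 d1 : bool) :
  w1 ==> d0 -> w1 ==> d1 -> w2 ==> ~~ d0 -> w2 ==> ~~ d1 ->
  z1 ==> d0 -> z2 ==> ~~ d0 -> v1 ==> d1 -> v2 ==> ~~ d1 ->
  ~~ ((w1 || w2) && (z1 || z2)) -> ~~ ((v1 || v2) && (w1 || w2)) ->
  ((w2 || d0 && ~~ w1) && (v2 || d1 && ~~ v1) +
   ((z2 || d0 && ~~ z1) && (w2 || d1 && ~~ w1) + (w1 + w2)) <=
   (w2 || z2 || [&& d0, ~~ w1 & ~~ z1]) && (v2 || w2 || [&& d1, ~~ v1 & ~~ w1]) +
   (d0 && d1 + ((z1 || z2) && (v1 || v2))))%N.
Proof.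
by case: w1; case: w2; case: z1; case: z2; case: v1; case: v2; case: d0; case: d1.
Qed.

(* In [1_D(x) 1_D(Sx)], modifying [D] on [W1 `|` W2] and on its image by [S]
   contributes a bilinear term to the mixed second difference: it is [1] on
   [W1 `|` W2], up to points returning to [W1 `|` W2], hence to [G], under [S^2]. *)
Lemma second_difference :
  2 * pr W1 - pr (G `&` S @^-1` (S @^-1` G)) <=
  q ((psi \o conj_psi) @^-1` D) - q (psi @^-1` D) - q (conj_psi @^-1` D) + q D.
Proof.
have mS A : measurable A -> measurable (S @^-1` A) by exact: imt_measurable.
have mSV A : measurable A -> measurable (SV @^-1` A) by exact: imt_inv_preim_measurable.
have mp (f : inv_mpt mu) A : measurable A -> measurable (f @^-1` A) by exact: imt_measurable.
have mq E : measurable E -> measurable (E `&` S @^-1` E).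
  by move=> mE; apply: measurableI => //; exact: mS.
(* The exceptional points: the preimage of [x] lies in [G] and returns to [G] under the second
   iterate of [S]. *)
pose Z := SV @^-1` (W1 `|` W2) `&` S @^-1` (W1 `|` W2).
have mW : measurable (W1 `|` W2) by exact: measurableU.
have mZ : measurable Z by apply: measurableI; [exact: mSV|exact: mS].
have prW : pr W2 = pr W1.
  rewrite -(pr_imt psi mW1); congr (pr _); apply/seteqP; split=> x;
  by rewrite /preimage/= W1C.
have prZ : pr Z <= pr (G `&` S @^-1` (S @^-1` G)).
  rewrite -[leRHS](pr_imt_inv S); last by apply: measurableI => //; exact/mS/mS.
  apply: pr_le => //; first by apply: mSV; apply: measurableI => //; exact/mS/mS.
  move=> x [W0 W1'].
  have GW y : (W1 `|` W2) y -> G y by move=> [/W1Y[]|/W2Y[]].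
  by split; [exact: GW|rewrite /preimage/= SSV; exact: GW].
have mD11 : measurable ((psi \o conj_psi) @^-1` D) by rewrite comp_preimage; exact: mp _ _ (mp _ _ mD).
have mD10 : measurable (psi @^-1` D) by exact: mp.
have mD01 : measurable (conj_psi @^-1` D) by exact: mp.
have := @pr_count_le _ _ _ mu
  [:: psi @^-1` D `&` S @^-1` (psi @^-1` D);
      conj_psi @^-1` D `&` S @^-1` (conj_psi @^-1` D); W1; W2]
  [:: (psi \o conj_psi) @^-1` D `&` S @^-1` ((psi \o conj_psi) @^-1` D);
      D `&` S @^-1` D; Z].
rewrite !big_cons !big_nil !addr0 -/(q _) -/(q _) -/(q _) -/(q _) prW => H.
suff H2 : q (psi @^-1` D) + (q (conj_psi @^-1` D) + (pr W1 + pr W1)) <=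
    q ((psi \o conj_psi) @^-1` D) + (q D + pr Z) by lra.
apply: H => [A|A|x].
- by rewrite !inE => /or4P[]/eqP -> //; exact: mq.
- by rewrite !inE => /or3P[]/eqP -> //; exact: mq.
rewrite !big_cons !big_nil !addn0.
pose b (P : Prop) := `[< P >].
have andE (A B : set X) y : `[< (A `&` B) y >] = b (A y) && b (B y) by exact: asbool_and.
have preE (E : set X) y : b ((S @^-1` E) y) = b (E (S y)) by [].
have preVE (E : set X) y : b ((SV @^-1` E) y) = b (E (SV y)) by [].
have E10 y : b ((psi @^-1` D) y) = b (W2 y) || b (D y) && ~~ b (W1 y).
  by rewrite /b -asbool_neg -asbool_and -asbool_or; apply: asbool_equiv_eq; exact: D10.
have E11 y : b (((psi \o conj_psi) @^-1` D) y) =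
    b (W2 y) || b (W2 (SV y)) || [&& b (D y), ~~ b (W1 y) & ~~ b (W1 (SV y))].
  by rewrite /b -!asbool_neg -!asbool_and -orbA -!asbool_or; apply: asbool_equiv_eq; exact: D11.
have E01 y : b ((conj_psi @^-1` D) y) = b (W2 (SV y)) || b (D y) && ~~ b (W1 (SV y)).
  by rewrite /b -asbool_neg -asbool_and -asbool_or; apply: asbool_equiv_eq; exact: D01.
have orE y : b ((W1 `|` W2) y) = b (W1 y) || b (W2 y) by exact: asbool_or.
have disjW y : ~~ ((b (W1 (S y)) || b (W2 (S y))) && (b (W1 y) || b (W2 y))).
  have WG z : b (W1 z) || b (W2 z) -> G z /\ ~ G (S z).
    by move=> /orP[]/asboolP; [move=> /W1Y[]|move=> /W2Y[]].
  by apply/negP => /andP[/WG[Gy _] /WG[_ /(_ Gy)]].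
rewrite !andE !(preE, preVE) !(E11, E01, E10, orE) !SVK -!/(b _); apply: count_ineq.
- by apply/implyP => /asboolP/W1Y[*]; apply/asboolP.
- by apply/implyP => /asboolP/W1Y[*]; apply/asboolP.
- by apply/implyP => /asboolP/W2Y[*]; apply/asboolP.
- by apply/implyP => /asboolP/W2Y[*]; apply/asboolP.
- by apply/implyP => /asboolP/W1Y[_ _ _]; rewrite SSV => ?; apply/asboolP.
- by apply/implyP => /asboolP/W2Y[_ _ _]; rewrite SSV => ?; apply/asboolP.
- by apply/implyP => /asboolP/W1Y[*]; apply/asboolP.
- by apply/implyP => /asboolP/W2Y[*]; apply/asboolP.
- by rewrite -[x in b (W1 x) || b (W2 x)]SSV; exact: disjW.
- exact: disjW.
Qed.

End second_difference.

(** * Perturbing within a finite partition so that some member of the family mixes badly *)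

Section perturbation.
Context d (X : measurableType d) (R : realType) (mu : probability X R).
Variable T : inv_mpt mu.
Hypothesis T_mixing : strong_mixing mu T.
Local Notation pr := (pr mu).

Variables (F : set (set X)) (e : R).
Hypothesis F_measurable : forall C, F C -> measurable C.
Hypothesis e_gt0 : 0 < e.
Hypothesis F_rich : forall (K : finType) (a : X -> K), label a ->
  exists2 C, F C & forall P, e <= pr (mismatch a C P).

(* [G := T^-m G0] with [m] large is nearly independent of the cells of [a] and
   [D]; then, for [n] large, so are [G] and [T^-n] of the cells, and the terms of
   the sum are close to products.  Taking [pr G0] small compared with [e ^+ 2]
   makes the return term [pr (G `&` T^-2n G)] negligible against this sum. *)
Lemma perturbation_mass (K : finType) (a : X -> K) (D G0 : set X) (m0 : nat) :
  label a -> measurable D -> measurable G0 ->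
  (forall P, e <= pr (mismatch a D P)) -> 0 < pr G0 ->
  exists (G : set X) (n : nat), [/\ measurable G, (m0 <= n)%N,
    pr (G `&` iter n T @^-1` (iter n T @^-1` G)) <= pr G0 ^+ 2 + pr G0 * e ^+ 2 / 4 &
    pr G0 * (1 - pr G0) * e ^+ 2 - pr G0 * e ^+ 2 / 8 <= \sum_(p : K * K) Num.min
      (pr ((G `&` D `&` iter n T @^-1` (D `\` G)) `&`
         (fun x => (a x, a (iter n T x))) @^-1` [set p]))
      (pr (((G `\` D) `&` iter n T @^-1` (~` D `\` G)) `&`
         (fun x => (a x, a (iter n T x))) @^-1` [set p]))].
Proof.
move=> la mD mG0 HD; set g := pr G0 => g0.
have g1 : g <= 1 by exact: pr_le1.
pose A k := a @^-1` [set k].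
have mA k : measurable (A k) by exact: la.
pose U (s : K * bool) := if s.2 then A s.1 `&` D else A s.1 `\` D.
have mU s : measurable (U s).
  by rewrite /U; case: s.2; [exact: measurableI|exact: measurableD].
pose kk : R := (#|{: K * K}|)%:R.
have kk0 : 0 <= kk by exact: ler0n.
(* Error budget: each of the [kk] pairs of labels loses [3 * h] and the return estimate loses [h];
   either total is at most [g * e ^+ 2 / 8]. *)
pose h : R := g * e ^+ 2 / (8 * (3 * kk + 1)).
have h0 : 0 < h.
  by rewrite divr_gt0// mulr_gt0// ?exprn_gt0//; lra.
have hk : h * (3 * kk + 1) = g * e ^+ 2 / 8.
  by rewrite /h; field; lra.
have T_mp := imt_measure_preserving T.
have [m Hm] := gap_small_fin T_mp T_mixing mU (fun=> mG0) h0.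
pose G := iter m T @^-1` G0.
have mG : measurable G by exact: (measurable_preim T_mp).
have prG : pr G = g by exact: (pr_preim T_mp).
have UG s : g * pr (U s) - h <= pr (U s `&` G).
  have := Hm m (leqnn m) s; rewrite /gap -/G -/g.
  have := ler_norm (- (pr (U s `&` G) - pr (U s) * g)); rewrite normrN; lra.
have UG' s : (1 - g) * pr (U s) - h <= pr (U s `\` G).
  have := Hm m (leqnn m) s; rewrite /gap -/G -/g.
  have := pr_split mu (mU s) mG.
  have := ler_norm (pr (U s `&` G) - pr (U s) * g); lra.
have mUG s : measurable (U s `&` G) by exact: measurableI.
have mUG' s : measurable (U s `\` G) by exact: measurableD.
have [n1 Hn1] := @gap_small_fin _ _ _ _ _ T_mp T_mixing
  ((K * bool) * (K * bool))%type
  (fun s => U s.1 `&` G) (fun s => U s.2 `\` G) h (fun=> mUG _) (fun=> mUG' _) h0.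
have [n2 Hn2] := gap_small T_mp T_mixing mG mG h0.
pose n := (m0 + n1 + n2)%N.
exists G, n; split=> //; first by rewrite /n -addnA leq_addr.
  have nn2 : (n2 <= n + n)%N by exact: leq_trans (leq_addl _ _) (leq_addr _ _).
  have := Hn2 _ nn2; rewrite /gap prG.
  have -> : iter (n + n) T @^-1` G = iter n T @^-1` (iter n T @^-1` G).
    by apply/seteqP; split=> x; rewrite /preimage/= iterD.
  have := ler_norm (pr (G `&` iter n T @^-1` (iter n T @^-1` G)) - g * g).
  have : h <= g * e ^+ 2 / 8 by rewrite -hk; nra.
  have : 0 <= g * e ^+ 2 by rewrite mulr_ge0 ?exprn_ge0// ltW.
  rewrite expr2; lra.
have pair_est s t : g * (1 - g) * (pr (U s) * pr (U t)) - 3 * h <=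
    pr ((U s `&` G) `&` iter n T @^-1` (U t `\` G)).
  have nn1 : (n1 <= n)%N by rewrite /n addnAC leq_addl.
  have := Hn1 _ nn1 (s, t); rewrite /gap /=.
  set p := pr (_ `&` _ @^-1` _).
  have := ler_norm (- (p - pr (U s `&` G) * pr (U t `\` G))); rewrite normrN.
  have := UG s; have := UG' t.
  have := pr_ge0 mu (U s `&` G); have := pr_le1 mu (mUG s).
  have := pr_ge0 mu (U t `\` G); have := pr_le1 mu (mUG' t).
  have := pr_ge0 mu (U s); have := pr_le1 mu (mU s).
  have := pr_ge0 mu (U t); have := pr_le1 mu (mU t).
  set u := pr (U s); set v := pr (U t); set y := pr (_ `&` _); set z := pr (_ `\` _).
  move=> v1 v0 u1 u0 z1 z0 y1 y0 zv yu pl ph.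
  have contract w r : 0 <= w -> w <= 1 -> r <= h -> w * r <= h.
    move=> w0 w1 rh; apply: le_trans (ler_wpM2l w0 rh) _.
    by apply: ler_piMl => //; exact: ltW.
  have s1 : g * u * ((1 - g) * v - z) <= h.
    apply: contract; [by rewrite mulr_ge0// ltW| |lra].
    by apply: mulr_ile1 => //; exact: ltW.
  have s2 : z * (g * u - y) <= h by apply: contract => //; lra.
  (* Telescoping: [(1 - g) * v] is replaced by [z], then [g * u] by [y], and mixing replaces [y * z]
     by the measure itself. Each replacement costs at most [h]. *)
  have -> : g * (1 - g) * (u * v) = g * u * ((1 - g) * v - z) + z * (g * u - y) + y * z.
    by ring.
  lra.
have eU : e <= \sum_k Num.min (pr (U (k, true))) (pr (U (k, false))).
  exact: (mismatch_min la mD HD).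
pose x k := pr (U (k, true)); pose y k := pr (U (k, false)).
pose b k := Num.min (x k) (y k).
have b0 k : 0 <= b k by rewrite le_min !pr_ge0.
(* The double sum is the square of [\sum_k b k], which is at least [e] by [mismatch_min]. *)
have eb : e ^+ 2 <= \sum_(p : K * K) b p.1 * b p.2.
  rewrite -(pair_bigA _ (fun k l => b k * b l))/=.
  under eq_bigr do rewrite -mulr_sumr.
  by rewrite -mulr_suml -expr2 lerXn2r ?nnegrE ?(ltW e_gt0)// sumr_ge0.
apply: le_trans (_ : _ <= \sum_(p : K * K) (g * (1 - g) * (b p.1 * b p.2) - 3 * h)) _.
  rewrite sumrB -mulr_sumr sumr_const -mulr_natl -/kk.
  have gg0 : 0 <= g * (1 - g) by rewrite mulr_ge0 ?subr_ge0// ltW.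
  have := ler_wpM2l gg0 eb.
  have : kk * (3 * h) <= g * e ^+ 2 / 8 by rewrite -hk; nra.
  by lra.
apply: ler_sum => -[k l] _ /=.
have E1 : (G `&` D `&` iter n T @^-1` (D `\` G)) `&`
    (fun x => (a x, a (iter n T x))) @^-1` [set (k, l)] =
    (U (k, true) `&` G) `&` iter n T @^-1` (U (l, true) `\` G).
  apply/seteqP; split=> z; rewrite /U /A /preimage/=.
    by move=> [[[Gz Dz] [Dz' Gz']] [az az']].
  by move=> [[[az Dz] Gz] [[az' Dz'] Gz']]; rewrite az az'.
have E2 : ((G `\` D) `&` iter n T @^-1` (~` D `\` G)) `&`
    (fun x => (a x, a (iter n T x))) @^-1` [set (k, l)] =
    (U (k, false) `&` G) `&` iter n T @^-1` (U (l, false) `\` G).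
  apply/seteqP; split=> z; rewrite /U /A /preimage/=.
    by move=> [[[Gz Dz] [Dz' Gz']] [az az']].
  by move=> [[[az Dz] Gz] [[az' Dz'] Gz']]; rewrite az az'.
rewrite E1 E2 le_min; have := pair_est (k, true) (l, true).
have := pair_est (k, false) (l, false).
have gg0 : 0 <= g * (1 - g) by rewrite mulr_ge0 ?subr_ge0// ltW.
have bx : b k * b l <= pr (U (k, true)) * pr (U (l, true)).
  by apply: ler_pM => //; rewrite ge_min lexx.
have by_ : b k * b l <= pr (U (k, false)) * pr (U (l, false)).
  by apply: ler_pM => //; rewrite ge_min lexx orbT.
have := ler_wpM2l gg0 bx; have := ler_wpM2l gg0 by_.
by move=> h1 h2 h3 h4; apply/andP; split; lra.
Qed.

Let T_mp := imt_measure_preserving T.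

Lemma perturbation (G0 : set X) (phi : inv_mpt mu) (K : finType) (a : X -> K)
    (m0 : nat) :
  label a -> measurable G0 -> 0 < pr G0 -> 4 * pr G0 <= e ^+ 2 ->
  exists C (n : nat) (psi : inv_mpt mu),
    [/\ F C, (m0 <= n)%N, forall x, a (psi x) = a x &
        pr G0 * e ^+ 2 / 16 <
          `|gap mu T n (imt_inv (imt_comp psi phi) @^-1` C)
                       (imt_inv (imt_comp psi phi) @^-1` C)|].
Proof.
move=> la mG0 g0 ge; set g := pr G0 in g0 ge *.
have laphi : label (a \o phi) by move=> k; exact: (imt_measurable phi (la k)).
(* The partition is pulled back by [phi], so that the image [D] of [C] is far from the cells of [a]
   itself. *)
have [C FC HC] := F_rich laphi.
have mC : measurable C by exact: F_measurable.
pose D := imt_inv phi @^-1` C.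
have mD : measurable D by exact: imt_inv_preim_measurable.
have HD P : e <= pr (mismatch a D P).
  rewrite -(pr_imt phi); last exact: measurable_mismatch.
  rewrite (_ : _ @^-1` _ = mismatch (a \o phi) C P)//.
  by apply/seteqP; split=> x; rewrite /mismatch /D /preimage/= imt_funK.
have e1 : e <= 1.
  by apply: le_trans (HD (fun=> true)) _; apply: pr_le1; exact: measurable_mismatch.
have [G [n [mG m0n crossE massE]]] := perturbation_mass m0 la mD mG0 HD g0.
pose S := imt_iter T n.
pose Y1 := G `&` D `&` S @^-1` (D `\` G).
pose Y2 := (G `\` D) `&` S @^-1` (~` D `\` G).
(* Keeping the label of [x] makes [psi] preserve [a]; keeping that of [S x] does the same for its
   conjugate. *)
pose c x := (a x, a (S x)).
have mY1 : measurable Y1.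
  by apply: measurableI; [exact: measurableI|exact/imt_measurable/measurableD].
have mY2 : measurable Y2.
  apply: measurableI; [exact: measurableD|apply: imt_measurable].
  by apply: measurableD => //; exact: measurableC.
have Y12 x : Y1 x -> ~ Y2 x by move=> [[_ Dx] _] [[_]].
have lc : label c.
  by apply: label_pair => // k; exact: (imt_measurable S (la k)).
have [psi [W1 [W2 [[mW1 mW2] [W1Y W2Y] psiK [psi1 psi2 psi_id psic] W1min]]]] :=
  exchange T_mixing lc mY1 mY2 Y12.
have prW1 : g * (1 - g) * e ^+ 2 - g * e ^+ 2 / 8 <= pr W1.
  apply: le_trans massE _; rewrite (pr_label mu lc mW1).
  by apply: ler_sum => p _; exact: W1min.
have := @second_difference _ _ _ mu S psi D G W1 W2 mD mG mW1 mW2.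
pose psi' := conj_psi S psi.
have apsi x : a (psi x) = a x by have [] := psic x.
have apsi' x : a (psi' x) = a x.
  have [_ h] := psic (imt_inv S x).
  by transitivity (a (S (imt_inv S x))); [exact: h|rewrite imt_invK].
have psi'K : involutive psi'.
  have psi'E x : psi' x = S (psi (imt_inv S x)) by [].
  by move=> x; rewrite !psi'E imt_funK psiK imt_invK.
have inv_invol (f : inv_mpt mu) : involutive f -> imt_inv f =1 f.
  by move=> fK x; rewrite -{1}(fK x) imt_funK.
move=> /(_ _ _ psi1 psi2 psi_id) H.
(* The four sets have the same measure, so the products subtracted in [gap] cancel in the second
   difference. *)
have {}H : 2 * pr W1 - pr (G `&` S @^-1` (S @^-1` G)) <=
  gap mu T n ((psi \o psi') @^-1` D) ((psi \o psi') @^-1` D)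
  - gap mu T n (psi @^-1` D) (psi @^-1` D) - gap mu T n (psi' @^-1` D) (psi' @^-1` D)
  + gap mu T n D D.
  apply: le_trans (H _ _) _.
  - by move=> x /W1Y[[Gx Dx] [Dx' Gx']].
  - by move=> x /W2Y[[Gx Dx] [Dx' Gx']].
  rewrite /gap comp_preimage !pr_imt//; last exact: imt_measurable.
  by lra.
have done_ (f : inv_mpt mu) : (forall x, a (f x) = a x) ->
    g * e ^+ 2 / 16 < `|gap mu T n (imt_inv f @^-1` D) (imt_inv f @^-1` D)| ->
    exists C (n : nat) (psi : inv_mpt mu), [/\ F C, (m0 <= n)%N, forall x, a (psi x) = a x &
        g * e ^+ 2 / 16 <
          `|gap mu T n (imt_inv (imt_comp psi phi) @^-1` C)
                       (imt_inv (imt_comp psi phi) @^-1` C)|].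
  by move=> af Hf; exists C, n, f.
have eqf (f : inv_mpt mu) : involutive f -> imt_inv f @^-1` D = f @^-1` D.
  by move=> fK; apply/seteqP; split=> x; rewrite /preimage/= inv_invol.
(* As [g <= e ^+ 2 / 4] and [g <= 1 / 4], the second difference is at least
   [2 * (5 / 8) - 1 / 2 = 3 / 4] times [g * e ^+ 2]. Its four terms cannot all be bounded by a
   sixteenth of that quantity. *)
have [h1|n1] := ltP (g * e ^+ 2 / 16) `|gap mu T n (psi @^-1` D) (psi @^-1` D)|.
  by apply: (done_ psi) => //; rewrite eqf.
have [h2|n2] := ltP (g * e ^+ 2 / 16) `|gap mu T n (psi' @^-1` D) (psi' @^-1` D)|.
  by apply: (done_ psi') => //; rewrite eqf.
have [h3|n3] := ltP (g * e ^+ 2 / 16) `|gap mu T n D D|.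
  exact: (done_ (imt_iter psi 0)).
apply: (done_ (imt_comp psi' psi)) => [x|]; first by rewrite /= apsi' apsi.
have -> : imt_inv (imt_comp psi' psi) @^-1` D = (psi \o psi') @^-1` D.
  by apply/seteqP; split=> x; rewrite /preimage/= !inv_invol.
apply: lt_le_trans (ler_norm _).
move: n1 n2 n3; rewrite !ler_norml => /andP[n1 _] /andP[n2 _] /andP[_ n3].
have ge0 : 0 < g * e ^+ 2 by rewrite mulr_gt0// exprn_gt0.
have gg : g ^+ 2 <= g * e ^+ 2 / 4 by rewrite expr2; nra.
have g4 : 4 * g <= 1 by apply: le_trans ge _; rewrite expr_le1// ltW.
have ggE : g * (g * e ^+ 2) <= g * e ^+ 2 / 4 by nra.
have prE : g * (1 - g) * e ^+ 2 = g * e ^+ 2 - g * (g * e ^+ 2) by ring.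
have {}crossE : pr (G `&` S @^-1` (S @^-1` G)) <= g ^+ 2 + g * e ^+ 2 / 4 by [].
move: prW1 H; rewrite prE; lra.
Qed.

End perturbation.

(** * Limits of automorphisms of a Lebesgue space *)

Section borel_laws.
Context d (X : measurableType d) (R : realType) (mu : probability X R).
Local Notation pr := (pr mu).

Lemma pr_eq_off (A B N : set X) :
  measurable A -> measurable B -> measurable N -> pr N = 0 ->
  (forall x, ~ N x -> (A x <-> B x)) -> pr A = pr B.
Proof.
move=> mA mB mN N0 AB; apply/eqP; rewrite eq_le.
have half C E : measurable C -> measurable E ->
    (forall x, ~ N x -> C x -> E x) -> pr C <= pr E.
  move=> mC mE CE; rewrite -[leRHS]addr0 -N0; apply: pr_leU => // x Cx.
  by have [?|Nx] := pselect (N x); [right|left; exact: CE].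
by rewrite !half// => x Nx; apply (AB x Nx).
Qed.

(** Open left rays form a generating pi-system, so two finite measures agreeing on them agree on all
    Borel sets. *)
Lemma pr_borel_unique (C D : set X) (h k : X -> R) :
  measurable C -> measurable D ->
  measurable_fun [set: X] h -> measurable_fun [set: X] k ->
  (forall t, pr (C `&` [set x | h x < t]) = pr (D `&` [set x | k x < t])) ->
  forall B : set R, measurable B -> pr (C `&` h @^-1` B) = pr (D `&` k @^-1` B).
Proof.
move=> mC mD mh mk HH B mB.
have meas (f : X -> R) (E : set R) : measurable_fun [set: X] f -> measurable E ->
    measurable (f @^-1` E).
  by move=> mf mE; rewrite -[X in measurable X]setTI; exact: mf.
pose m1 := measure_function_pushforward__canonical__measure_function_Measure (mrestr mu mC) mh.
pose m2 := measure_function_pushforward__canonical__measure_function_Measure (mrestr mu mD) mk.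
have m1E E : m1 E = mu (h @^-1` E `&` C) by [].
have m2E E : m2 E = mu (k @^-1` E `&` D) by [].
clearbody m1 m2; have : m1 B = m2 B.
  apply: (@measure_unique _ _ _ (@RGenInftyO.G R) (fun n => `]-oo, n%:R[%classic)) => //.
  - exact: RGenInftyO.measurableE.
  - move=> _ _ [x ->] [y ->]; exists (Num.min x y).
    by apply/seteqP; split=> z; rewrite /setI /= !in_itv/= lt_min; [case=> -> ->|move=> /andP[]].
  - by move=> i; exists i%:R.
  - apply/seteqP; split=> // x _; exists `|Num.ceil x|%N.+1 => //=.
    rewrite in_itv/= -natr1 natr_absz intr_norm.
    have := ceil_ge x; have := ler_norm ((Num.ceil x)%:~R : R); lra.
  - move=> _ [t ->].
    have ray (f : X -> R) : f @^-1` `]-oo, t[ = [set x | f x < t].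
      by apply/seteqP; split=> x; rewrite /preimage/= in_itv.
    have mray (f : X -> R) : measurable_fun [set: X] f -> measurable [set x | f x < t].
      by move=> mf; rewrite -ray; exact: meas.
    rewrite m1E m2E !ray (setIC _ C) (setIC _ D) !(prE mu); first by rewrite HH.
      by apply: measurableI => //; exact: mray.
    by apply: measurableI => //; exact: mray.
  - move=> n; rewrite m1E.
    rewrite -ge0_fin_numE ?measure_ge0// fin_num_measure//.
    by apply: measurableI => //; apply: meas.
by rewrite m1E m2E (setIC _ C) (setIC _ D) /pr => ->.
Qed.

End borel_laws.

(** * Uniformly distributed real coordinates on a Lebesgue space *)

Section coordinates.
Context d (X : measurableType d) (R : realType) (mu : probability X R).
Local Notation pr := (pr mu).
Local Notation lambda := (@lebesgue_measure R).

(* [coord_realize] is what is left of the completeness of a Lebesgue space: any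
   function [h] with the distribution of [u] is, up to a null set, [u \o alpha]. *)
Record coordinate (u : X -> R) (X0 : set X) : Prop := Coordinate {
  coord_measurable : measurable_fun [set: X] u;
  coord_itv : forall x, 0 <= u x < 1;
  coord_law : forall t, 0 <= t <= 1 -> pr [set x | u x < t] = t;
  coord_dom : measurable X0;
  coord_dom0 : pr (~` X0) = 0;
  coord_inj : forall x y, X0 x -> X0 y -> u x = u y -> x = y;
  coord_realize : forall h : X -> R, measurable_fun [set: X] h ->
    (forall t, pr [set x | h x < t] = pr [set x | u x < t]) ->
    exists (alpha : X -> X) (N : set X), [/\ measurable_fun [set: X] alpha,
      measurable N /\ pr N = 0,
      forall x, ~ N x -> u (alpha x) = h x /\ X0 (alpha x) &
      forall C D, measurable C -> measurable D ->
        (forall t, pr (C `&` [set x | h x < t]) = pr (D `&` [set x | u x < t])) ->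
        forall A, measurable A -> pr (C `&` alpha @^-1` A) = pr (D `&` A)] }.

Section construction.
Variables (X' : set X) (f : X -> R).
Hypotheses (mX' : measurable X') (X'0 : pr (~` X') = 0).
Hypothesis f_inj : forall x y, X' x -> X' y -> f x = f y -> x = y.
Hypothesis f_itv : forall x, X' x -> 0 <= f x < 1.
(** Images are Borel only modulo null sets, and [f_pull] concerns only functions that pull null sets
    back to null sets. In this form the hypotheses cover both the Borel and the completed model. *)
Hypothesis f_borel : forall A, measurable A -> A `<=` X' ->
  exists B N : set R, [/\ measurable B, measurable N, lambda N = 0%E &
    forall t, ~ N t -> ((f @` A) t <-> B t)].
Hypothesis mf : forall B : set R, measurable B -> measurable (X' `&` f @^-1` B).
Hypothesis f_law : forall t, 0 <= t <= 1 -> pr (X' `&` f @^-1` `]-oo, t[) = t.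
Hypothesis f_null : forall N : set R, measurable N -> lambda N = 0%E ->
  pr (X' `&` f @^-1` N) = 0.
Hypothesis f_pull : forall h : X -> R, measurable_fun [set: X] h ->
  (forall N : set R, measurable N -> lambda N = 0%E -> pr (h @^-1` N) = 0) ->
  forall A, measurable A -> A `<=` X' -> measurable (X' `&` h @^-1` (f @` A)).

Let u x : R := if pselect (X' x) then f x else 0.

Let uE x : X' x -> u x = f x. Proof. by rewrite /u; case: pselect. Qed.
Let uE0 x : ~ X' x -> u x = 0. Proof. by rewrite /u; case: pselect. Qed.

Let meas (h : X -> R) (E : set R) : measurable_fun [set: X] h -> measurable E ->
  measurable (h @^-1` E).
Proof. by move=> mh mE; rewrite -[X in measurable X]setTI; exact: mh. Qed.

Let mu_ : measurable_fun [set: X] u.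
Proof.
move=> _ B mB; rewrite setTI; have [B0|nB0] := pselect (B 0).
  rewrite (_ : u @^-1` B = (X' `&` f @^-1` B) `|` ~` X').
    by apply: measurableU; [exact: mf|exact: measurableC].
  apply/seteqP; split=> x; rewrite /preimage/= /u; case: pselect => //= Xx.
  - by left.
  - by right.
  - by case=> [[]|].
rewrite (_ : u @^-1` B = X' `&` f @^-1` B); first exact: mf.
by apply/seteqP; split=> x; rewrite /preimage/= /u; case: pselect => //= Xx [].
Qed.

Let u_itv x : 0 <= u x < 1.
Proof.
have [Xx|nX] := pselect (X' x); first by rewrite uE//; exact: f_itv.
by rewrite uE0// lexx ltr01.
Qed.

Let pr_u (D : set X) (B : set R) : measurable D -> measurable B ->
  pr (D `&` u @^-1` B) = pr (D `&` (X' `&` f @^-1` B)).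
Proof.
move=> mD mB; apply: (@pr_eq_off _ _ _ _ _ _ (~` X')) => //.
- by apply: measurableI => //; exact: meas.
- by apply: measurableI => //; exact: mf.
- exact: measurableC.
move=> x /contrapT Xx; rewrite /setI /preimage/= uE//; tauto.
Qed.

Let ray (h : X -> R) t : h @^-1` `]-oo, t[ = [set x | h x < t].
Proof. by apply/seteqP; split=> x; rewrite /preimage/= in_itv. Qed.

Let u_law t : 0 <= t <= 1 -> pr [set x | u x < t] = t.
Proof.
move=> t01; rewrite -[RHS](f_law t01) -ray.
by have := @pr_u setT `]-oo, t[ measurableT; rewrite !setTI; apply.
Qed.

Section realize.
Variable h : X -> R.
Hypothesis mh : measurable_fun [set: X] h.
Hypothesis h_law : forall t, pr [set x | h x < t] = pr [set x | u x < t].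

Let h_null (N : set R) : measurable N -> lambda N = 0%E -> pr (h @^-1` N) = 0.
Proof.
move=> mN N0; have := @pr_borel_unique _ _ _ mu setT setT h u measurableT
  measurableT mh mu_.
move=> /(_ _ N mN); rewrite !setTI => -> => [|t]; last by rewrite !setTI.
have := pr_u measurableT mN; rewrite !setTI => ->; exact: f_null.
Qed.

(** The preimage of [A] under the map [alpha] defined below, which is [f^-1 \o h] wherever this
    makes sense. *)
Let pull (A : set X) := X' `&` h @^-1` (f @` (A `&` X')).

Let mpull A : measurable A -> measurable (pull A).
Proof. by move=> mA; apply: f_pull => //; exact: measurableI. Qed.

(** The image of [A] is replaced by a Borel set off a null set. The laws of [h] on [C] and of [u] on
    [D] agree on it, and injectivity of [f] leads back to [A]. *)
Let pr_pull (C D A : set X) : measurable C -> measurable D -> measurable A ->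
  (forall t, pr (C `&` [set x | h x < t]) = pr (D `&` [set x | u x < t])) ->
  pr (C `&` pull A) = pr (D `&` A).
Proof.
move=> mC mD mA CD.
have [B [N [mB mN N0 BN]]] := f_borel (measurableI _ _ mA mX') (@subIsetr _ _ _).
transitivity (pr (C `&` h @^-1` B)).
  apply: (@pr_eq_off _ _ _ _ _ _ (~` X' `|` h @^-1` N)).
  - by apply: measurableI => //; exact: mpull.
  - by apply: measurableI => //; exact: meas.
  - by apply: measurableU; [exact: measurableC|exact: meas].
  - apply/eqP; rewrite eq_le pr_ge0 andbT -[leRHS]addr0 -{1}X'0 -(h_null mN N0).
    apply: pr_leU => //; [|exact: measurableC|exact: meas].
    by apply: measurableU; [exact: measurableC|exact: meas].
  move=> x /not_orP[/contrapT Xx Nx]; rewrite /pull /setI /preimage/=.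
  have [h1 h2] := BN _ Nx; split.
    by move=> [Cx [_ ABx]]; split=> //; exact: h1.
  by move=> [Cx Bx]; do 2!split=> //; exact: h2.
rewrite (pr_borel_unique mC mD mh mu_ CD mB) pr_u//.
apply: (@pr_eq_off _ _ _ _ _ _ (~` X' `|` (X' `&` f @^-1` N))).
- by apply: measurableI => //; exact: mf.
- exact: measurableI.
- by apply: measurableU; [exact: measurableC|exact: mf].
- apply/eqP; rewrite eq_le pr_ge0 andbT -[leRHS]addr0 -{1}X'0 -(f_null mN N0).
  apply: pr_leU => //; [|exact: measurableC|exact: mf].
  by apply: measurableU; [exact: measurableC|exact: mf].
move=> x /not_orP[/contrapT Xx nN]; have Nx : ~ N (f x) by move=> ?; apply: nN.
have [h1 h2] := BN _ Nx; split.
  move=> [Dx [_ /h2[y [Ay Xy] fy]]]; split=> //.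
  by rewrite -(f_inj Xy Xx fy).
by move=> [Dx Ax]; do 2!split=> //; apply: h1; exists x.
Qed.

Let alpha x : X := match pselect (exists y, X' x /\ X' y /\ f y = h x) with
  | left H => projT1 (cid H) | right _ => x end.

Let alphaE x y : X' x -> X' y -> f y = h x -> alpha x = y.
Proof.
move=> Xx Xy fy; rewrite /alpha; case: pselect => [H|[]]; last by exists y.
case: cid => z /= [_ [Xz fz]]; apply: f_inj => //; by rewrite fz.
Qed.

Let pull_alpha A x : pull A x -> A (alpha x).
Proof. by move=> [Xx [y [Ay Xy] fy]]; rewrite (alphaE Xx Xy fy). Qed.

Let alpha_off x : ~ pull setT x -> alpha x = x.
Proof.
move=> np; rewrite /alpha; case: pselect => // -[y [Xx [Xy fy]]].
by case: np; split=> //; exists y.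
Qed.

Let alpha_preim A : alpha @^-1` A = pull A `|` (A `\` pull setT).
Proof.
apply/seteqP; split=> x; rewrite /preimage/=; last first.
  by move=> [/pull_alpha//|[Ax np]]; rewrite alpha_off.
have [[Xx [y [_ Xy] fy]]|np] := pselect (pull setT x).
  by rewrite (alphaE Xx Xy fy) => Ay; left; split=> //; exists y.
by rewrite alpha_off// => Ax; right.
Qed.

Let pr_pullT : pr (~` pull setT) = 0.
Proof.
rewrite pr_setC; last exact: mpull.
have := @pr_pull setT setT setT measurableT measurableT measurableT.
rewrite !setTI pr_setT => ->; first by rewrite subrr.
by move=> t; rewrite !setTI.
Qed.

Lemma coordinate_realization : exists (alpha : X -> X) (N : set X), [/\ measurable_fun [set: X] alpha,
    measurable N /\ pr N = 0,
    forall x, ~ N x -> u (alpha x) = h x /\ X' (alpha x) &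
    forall C D, measurable C -> measurable D ->
      (forall t, pr (C `&` [set x | h x < t]) = pr (D `&` [set x | u x < t])) ->
      forall A, measurable A -> pr (C `&` alpha @^-1` A) = pr (D `&` A)].
Proof.
exists alpha, (~` pull setT); split.
- move=> _ A mA; rewrite setTI alpha_preim; apply: measurableU; first exact: mpull.
  by apply: measurableD => //; exact: mpull.
- by split=> //; apply: measurableC; exact: mpull.
- move=> x /contrapT[Xx [y [_ Xy] fy]].
  by rewrite (alphaE Xx Xy fy) uE.
- move=> C D mC mD CD A mA; rewrite -(pr_pull mC mD mA CD).
  apply: (@pr_eq_off _ _ _ _ _ _ (~` pull setT)) => //.
  + apply: measurableI => //; rewrite alpha_preim.
    by apply: measurableU; [|apply: measurableD => //]; exact: mpull.
  + by apply: measurableI => //; exact: mpull.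
  + by apply: measurableC; exact: mpull.
  move=> x /contrapT px; rewrite alpha_preim /setI /setU /setD/=; tauto.
Qed.

End realize.

Lemma coordinate_of_iso : coordinate u X'.
Proof.
split=> //; last exact: coordinate_realization.
by move=> x y Xx Xy; rewrite !uE//; exact: f_inj.
Qed.

End construction.

Lemma iso_law d' (Y : measurableType d') (nu : {measure set Y -> \bar R})
    (E E' : set Y) (X' : set X) (f : X -> Y) :
  measurable E -> measurable E' -> E' `<=` E -> nu (E `\` E') = 0%E ->
  set_bij X' E' f ->
  (forall B, measurable B -> B `<=` E' -> mu (X' `&` f @^-1` B) = nu B) ->
  forall B, measurable B -> mu (X' `&` f @^-1` B) = nu (B `&` E).
Proof.
move=> mE mE' E'E nuE [fE _ _] fnu B mB.
rewrite (_ : X' `&` _ = X' `&` f @^-1` (B `&` E')); last first.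
  apply/seteqP; split=> x [Xx Bx]; split=> //; last by case: Bx.
  by split=> //; exact: fE.
rewrite fnu; [|exact: measurableI|exact: subIsetr].
have mBE : measurable (B `&` E) by exact: measurableI.
rewrite (measureDI nu mBE mE') -setIA (setIidr E'E).
rewrite (@subset_measure0 _ _ _ nu (B `&` E `\` E') (E `\` E')) ?add0e//.
- by apply: measurableD.
- by apply: measurableD.
by move=> x [[_ ?] ?].
Qed.

Lemma coordinate_of_law (X' : set X) (f : X -> R) :
  measurable X' -> mu (~` X') = 0%E ->
  set_inj X' f -> (forall x, X' x -> 0 <= f x < 1) ->
  (forall A, measurable A -> A `<=` X' ->
    exists B N : set R, [/\ measurable B, measurable N, lambda N = 0%E &
      forall t, ~ N t -> ((f @` A) t <-> B t)]) ->
  (forall B : set R, measurable B -> measurable (X' `&` f @^-1` B) /\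
    mu (X' `&` f @^-1` B) = lambda (B `&` `[0, 1[)) ->
  (forall h : X -> R, measurable_fun [set: X] h ->
    (forall N : set R, measurable N -> lambda N = 0%E -> pr (h @^-1` N) = 0) ->
    forall A, measurable A -> A `<=` X' -> measurable (X' `&` h @^-1` (f @` A))) ->
  exists u X0, coordinate u X0.
Proof.
move=> mX' X'0 finj f01 fapp flaw fpull.
eexists; exists X'; apply: (@coordinate_of_iso _ f) => //.
- by rewrite /pr X'0.
- by move=> x y Xx Xy; apply: finj; rewrite inE.
- by move=> B /flaw[].
- move=> t /andP[t0 t1]; rewrite /pr (flaw _ _).2//.
  rewrite (_ : _ `&` _ = `[0, t[%classic); last first.
    apply/seteqP; split=> x; rewrite /setI/= !in_itv/=.
      by move=> [-> /andP[->]].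
    by move=> /andP[-> xt]; split=> //; rewrite (lt_le_trans xt).
  rewrite lebesgue_measure_itv/= lte_fin; case: ltP => t0'; first by rewrite sube0.
  by apply/eqP; rewrite eq_le t0 t0'.
- move=> N mN N0; rewrite /pr (flaw _ mN).2.
  rewrite (@subset_measure0 _ _ _ lambda _ N)//.
  exact: measurableI.
Qed.

Lemma lebesgue_coordinate : lebesgue_space mu -> exists u X0, coordinate u X0.
Proof.
case=> -[X' [E' [f [[mX' X'0] [mE' E'E nuE] bijf [mf fm] fnu]]]].
  have [fE finj _] := bijf.
  apply: (@coordinate_of_law X' f) => //.
  - by move=> x /fE/E'E; rewrite /= in_itv.
  - move=> A mA AX; exists (f @` A), set0; split=> //; exact: fm.
  - move=> B mB; split; first exact: mf.
    exact: (iso_law _ mE' E'E nuE bijf fnu mB).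
  - move=> h mh hnull A mA AX; apply: measurableI => //.
    rewrite -[X in measurable X]setTI; apply: mh => //; exact: fm.
have [fE finj _] := bijf.
have cB (B : set R) : measurable B -> ((@wlength R idfun)^*)%mu.-cara.-measurable B.
  exact: sub_caratheodory.
have cN : (@completed_lebesgue_measure R).-negligible `<=`
  ((@wlength R idfun)^*)%mu.-cara.-measurable := negligible_sub_caratheodory.
have img A : measurable A -> A `<=` X' -> X' `&` f @^-1` (f @` A) = A.
  move=> mA AX; apply/seteqP; split=> [x [Xx [y Ay fy]]|x Ax]; last first.
    by split; [exact: AX|exists x].
  by rewrite -(finj _ _ _ _ fy)// inE//; exact: AX.
(* A Lebesgue measurable set is a Borel set [B] together with a subset [N0] of a Borel null set
   [N]. *)
have dec A : measurable A -> A `<=` X' -> exists (B N0 N : set R),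
    [/\ measurable B, measurable N, lambda N = 0%E, N0 `<=` N & f @` A = B `|` N0].
  move=> mA AX; have := fm _ mA AX.
  rewrite -completed_caratheodory_measurable g_sigma_completed_algebra_genE.
  by move=> [B mB [N0 [N [mN N_0 NN]] <-]]; exists B, N0, N.
apply: (@coordinate_of_law X' f) => //.
- by move=> x /fE/E'E; rewrite /= in_itv.
- move=> A mA AX; have [B [N0 [N [mB mN N_0 N0N ->]]]] := dec _ mA AX.
  by exists B, N; split=> // t nN; split=> [[//|/N0N]//|]; left.
- move=> B mB; split; first by apply: mf => //; exact: cB.
  apply: (iso_law _ mE' E'E nuE bijf fnu); last exact: cB.
  by apply: cB; exact: measurable_itv.
- move=> h mh hnull A mA AX; have [B [N0 [N [mB mN N_0 N0N ->]]]] := dec _ mA AX.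
  have meas (E : set R) : measurable E -> measurable (h @^-1` E).
    by move=> mE; rewrite -[X in measurable X]setTI; exact: mh.
  rewrite preimage_setU setIUr; apply: measurableU.
    by apply: measurableI => //; exact: meas.
  (* Completeness is transported from the line: the image under [f] of the preimage of [N0] lies in
     that of the null set [Z], hence is Lebesgue measurable, and is pulled back by [f]. *)
  pose Z := X' `&` h @^-1` N.
  have mZ : measurable Z by apply: measurableI => //; exact: meas.
  have ZX : Z `<=` X' by exact: subIsetl.
  have Z0 : mu Z = 0%E.
    rewrite (prE mu)//; congr EFin; apply/eqP; rewrite eq_le pr_ge0 andbT.
    by rewrite -(hnull _ mN N_0); apply: pr_le; [|exact: meas|exact: subIsetr].
  set S := X' `&` h @^-1` N0.
  have SZ : S `<=` Z by move=> x [Xx /N0N].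
  have SE : X' `&` f @^-1` (f @` S) = S.
    apply/seteqP; split=> [x [Xx [y Sy fy]]|x Sx].
      by rewrite -(finj _ _ _ _ fy)// inE//; exact/ZX/SZ.
    by split; [exact/ZX/SZ|exists x].
  rewrite -SE; apply: mf => //; apply: cN; exists (f @` Z); split.
  + exact: fm.
  + rewrite -[LHS]fnu ?img//; first exact: fm.
    by move=> _ [x /ZX Xx <-]; exact: fE.
  + exact: image_subset.
Qed.

End coordinates.

(** * Equality modulo null sets, and automorphisms from maps inverse to each other almost
    everywhere *)

Section almost_everywhere.
Context d (X : measurableType d) (R : realType) (mu : probability X R).
Local Notation pr := (pr mu).

Lemma ae_null (N : set X) (P : X -> Prop) : measurable N -> pr N = 0 ->
  (forall x, ~ N x -> P x) -> {ae mu, forall x, P x}.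
Proof.
move=> mN N0 NP; exists N; split=> //; first by rewrite (prE mu)// N0.
by move=> x /= nP; apply: contrapT => /NP.
Qed.

Lemma ae_pull (f : X -> X) (P : X -> Prop) : measure_preserving mu f ->
  {ae mu, forall x, P x} -> {ae mu, forall x, P (f x)}.
Proof.
move=> [mf muf] [N [mN N0 PN]]; exists (f @^-1` N); split.
- by rewrite -[X in measurable X]setTI; exact: mf.
- by rewrite -N0; exact: muf.
- by move=> x /= nP; apply: PN.
Qed.

Lemma pr_ae_eq (A B : set X) : measurable A -> measurable B ->
  {ae mu, forall x, A x <-> B x} -> pr A = pr B.
Proof.
move=> mA mB [N [mN N0 AB]]; apply: (pr_eq_off mA mB mN).
  by rewrite /pr [X in fine X]N0.
by move=> x Nx; apply: contrapT => nAB; apply: Nx; exact: AB.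
Qed.

Lemma ae_eq_of_prI (A B : set X) : measurable A -> measurable B ->
  pr (A `&` B) = pr A -> pr A = pr B -> {ae mu, forall x, A x <-> B x}.
Proof.
move=> mA mB AB AB'.
have mAB : measurable (A `\` B) by exact: measurableD.
have mBA : measurable (B `\` A) by exact: measurableD.
apply: (@ae_null ((A `\` B) `|` (B `\` A))); first exact: measurableU.
  apply/eqP; rewrite eq_le pr_ge0 andbT.
  have <- : pr (A `\` B) + pr (B `\` A) = 0.
    have := pr_split mu mA mB; have := pr_split mu mB mA.
    by rewrite setIC AB; lra.
  by apply: pr_leU => //; exact: measurableU.
move=> x /not_orP[nAB nBA]; split=> [Ax|Bx]; apply: contrapT => nx.
  by apply: nAB.
by apply: nBA.
Qed.

Lemma mp_preim_measurable (f : X -> X) A : measure_preserving mu f ->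
  measurable A -> measurable (f @^-1` A).
Proof. by move=> [mf _] mA; rewrite -[X in measurable X]setTI; exact: mf. Qed.

(* The points all of whose images under words in [alpha] and [beta] avoid the
   exceptional null set form an invariant conull set; outside of it, use [id]. *)
Lemma imt_of_ae_inverse (alpha beta : X -> X) :
  measure_preserving mu alpha -> measure_preserving mu beta ->
  {ae mu, forall x, beta (alpha x) = x} -> {ae mu, forall x, alpha (beta x) = x} ->
  exists phi : inv_mpt mu, {ae mu, forall x, phi x = alpha x}.
Proof.
move=> amp bmp ba ab.
have [N [mN N0 HN]] : {ae mu, forall x, beta (alpha x) = x /\ alpha (beta x) = x}.
  by apply: filterS2 ba ab.
have good x : ~ N x -> beta (alpha x) = x /\ alpha (beta x) = x.
  by move=> Nx; apply: contrapT => H; apply: Nx; exact: HN.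
pose act (b : bool) := if b then alpha else beta.
pose run (w : seq bool) x := foldl (fun y b => act b y) x w.
have amp_act b : measure_preserving mu (act b) by case: b.
have mp_run w : measure_preserving mu (run w).
  elim: w => [|b w [mrw IH]].
    by split=> [|A mA]; [exact: (@measurable_id _ _ setT)|].
  have [mb mub] := amp_act b; rewrite (_ : run _ = run w \o act b)//; split; first exact: measurableT_comp.
  move=> A mA; rewrite -[RHS]IH// -[RHS]mub//.
  by rewrite -[X in measurable X]setTI; exact: mrw.
pose word n : seq bool := odflt [::] (choice.unpickle n).
pose X0 := \bigcap_n (run (word n) @^-1` (~` N)).
have X0P x : X0 x <-> forall w, ~ N (run w x).
  split=> [H w|H n _]; last exact: H.
  by have := H (choice.pickle w) I; rewrite /preimage/= /word choice.pickleK.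
have mX0 : measurable X0.
  apply: bigcapT_measurable => n; apply: mp_preim_measurable (mp_run _) _.
  exact: measurableC.
have X0ae : {ae mu, forall x, X0 x}.
  have : {ae mu, forall x, forall n, ~ N (run (word n) x)}.
    apply: ae_foralln => n; apply: (ae_pull (P := fun y => ~ N y)) (mp_run _) _.
    by exists N; split=> // x /= /contrapT.
  by apply: filterS => x H n _; exact: H.
have X0act b x : X0 x -> X0 (act b x).
  by move=> /X0P H; apply/X0P => w; exact: (H (b :: w)).
pose f b x := if pselect (X0 x) then act b x else x.
have fE b x : X0 x -> f b x = act b x by rewrite /f; case: pselect.
have fE0 b x : ~ X0 x -> f b x = x by rewrite /f; case: pselect.
have actK b x : X0 x -> act (~~ b) (act b x) = x.
  by move=> /X0P/(_ [::])/good[]; case: b.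
have fK b : cancel (f b) (f (~~ b)).
  move=> x; have [Xx|nX] := pselect (X0 x); last by rewrite !fE0.
  by rewrite (fE b)// fE ?actK//; exact: X0act.
have mf b : measurable_fun [set: X] (f b).
  move=> _ A mA; rewrite setTI.
  rewrite (_ : f b @^-1` A = (X0 `&` act b @^-1` A) `|` (A `\` X0)).
    apply: measurableU; last exact: measurableD.
    by apply: measurableI => //; exact: mp_preim_measurable.
  apply/seteqP; split=> x; rewrite /preimage/=.
    have [Xx|nX] := pselect (X0 x); first by rewrite fE//; left.
    by rewrite fE0//; right.
  by move=> [[Xx Ax]|[Ax nX]]; [rewrite fE|rewrite fE0].
have fmp : measure_preserving mu (f true).
  split=> // A mA; rewrite -(amp.2 _ mA).
  have mfA : measurable (f true @^-1` A) by rewrite -[X in measurable X]setTI; exact: mf.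
  have maA := mp_preim_measurable amp mA.
  rewrite !(prE mu)//; congr EFin; apply: pr_ae_eq => //.
  by apply: filterS X0ae => x Xx; rewrite /preimage/= fE.
exists (InvMpt fmp (mf false) (fK true) (fK false)).
by apply: filterS X0ae => x Xx /=; rewrite fE.
Qed.

End almost_everywhere.

(** * Dyadic intervals and uniform limits *)

Section dyadic_limits.
Context (R : realType).

(** For nonnegative reals: [a] and [b] lie in the same half-open dyadic interval of length
    [2 ^- k]. *)
Definition same_dyadic (k : nat) (a b : R) :=
  forall i : nat, (a < i%:R / 2 ^+ k) <-> (b < i%:R / 2 ^+ k).

Lemma same_dyadic_dist k a b : 0 <= a -> 0 <= b -> same_dyadic k a b ->
  `|a - b| <= (2 ^+ k)^-1.
Proof.
move=> a0 b0 ab.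
have k0 : 0 < 2 ^+ k :> R by rewrite exprn_gt0.
have half x y : 0 <= x -> same_dyadic k x y -> y - x <= (2 ^+ k)^-1.
  move=> x0 xy; have /truncn_itv/andP[t1 t2] : 0 <= x * 2 ^+ k by rewrite mulr_ge0// ltW.
  have : y < (Num.trunc (x * 2 ^+ k)).+1%:R / 2 ^+ k.
    by apply/xy; rewrite ltr_pdivlMr.
  have : (Num.trunc (x * 2 ^+ k))%:R / 2 ^+ k <= x by rewrite ler_pdivrMr.
  by rewrite -[(Num.trunc _).+1%:R]natr1 mulrDl mul1r; lra.
have ba : same_dyadic k b a by move=> i; split=> /ab.
by rewrite ler_norml; have := half _ _ a0 ab; have := half _ _ b0 ba; lra.
Qed.

Lemma same_dyadic_le k j a b : (k <= j)%N -> same_dyadic j a b -> same_dyadic k a b.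
Proof.
move=> kj ab i; have := ab (i * 2 ^ (j - k))%N.
rewrite (_ : (i * 2 ^ (j - k))%:R / 2 ^+ j = i%:R / 2 ^+ k)//.
by rewrite natrM natrX -{2}(subnK kj) exprD invfM mulrA mulfK//.
Qed.

Lemma exprV2_lt (e : R) : 0 < e -> exists k, (2 ^+ k)^-1 < e.
Proof.
move=> e0; exists (Num.trunc e^-1).+1.
rewrite -[ltRHS]invrK ltf_pV2 ?posrE ?exprn_gt0 ?invr_gt0//.
have /truncn_itv/andP[_ h] : 0 <= e^-1 by rewrite invr_ge0 ltW.
by apply: lt_trans h _; rewrite -natrX ltr_nat ltn_expl.
Qed.

Lemma measurable_limit d (X : measurableType d) (h : nat -> X -> R) :
  (forall j, measurable_fun [set: X] (h j)) ->
  (forall j x, `|h j.+1 x - h j x| <= (2 ^+ j)^-1) ->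
  exists2 l : X -> R, measurable_fun [set: X] l &
    forall j x, `|l x - h j x| <= 2 * (2 ^+ j)^-1.
Proof.
move=> mh hC.
(* The geometric tail from [j] on is [2 * (2 ^+ j)^-1]. Subtracting it gives a nondecreasing
   sequence and adding it a nonincreasing one, and these squeeze the limit. *)
pose lo x j := h j x - 2 * (2 ^+ j)^-1.
have halve j : (2 ^+ j.+1)^-1 = (2 ^+ j)^-1 / 2 :> R.
  by rewrite exprS invfM mulrC.
have p0 j : 0 < (2 ^+ j)^-1 :> R by rewrite invr_gt0 exprn_gt0.
have lo_nd x : {homo lo x : n m / (n <= m)%N >-> n <= m}.
  apply/nondecreasing_seqP => j; rewrite /lo halve.
  by have := hC j x; rewrite ler_norml => /andP[]; have := p0 j; lra.
have hi_ni x j n : h (j + n)%N x + 2 * (2 ^+ (j + n))^-1 <= h j x + 2 * (2 ^+ j)^-1.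
  elim: n => [|n]; first by rewrite addn0.
  apply: le_trans; rewrite addnS halve.
  by have := hC (j + n)%N x; rewrite ler_norml => /andP[]; have := p0 (j + n)%N; lra.
have lo_hi x j n : lo x n <= h j x + 2 * (2 ^+ j)^-1.
  apply: le_trans (lo_nd x _ _ (leq_addl j n)) _; apply: le_trans (hi_ni x j n).
  by rewrite /lo; have := p0 (j + n)%N; lra.
have lo_cvg x : cvgn (lo x).
  apply: nondecreasing_is_cvgn => //.
  by exists (h 0%N x + 2 * (2 ^+ 0)^-1) => _ [n _ <-]; exact: lo_hi.
exists (fun x => limn (lo x)).
  apply: (measurable_fun_cvg (h := fun j x => lo x j)) => [j|x _]; last exact: lo_cvg.
  by apply: measurable_funB.
move=> j x; rewrite ler_norml; apply/andP; split.
  by have := nondecreasing_cvgn_le (lo_nd x) (lo_cvg x) j; rewrite /lo; lra.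
rewrite lerBlDl; apply: limr_le => //; apply: nearW => n; exact: lo_hi.
Qed.

End dyadic_limits.

(** * Convergence of automorphisms together with their inverses *)

Section limit_of_automorphisms.
Context d (X : measurableType d) (R : realType) (mu : probability X R).
Local Notation pr := (pr mu).
Variables (u : X -> R) (X0 : set X).
Hypothesis cu : coordinate mu u X0.

Lemma measurable_sublevel (h : X -> R) t : measurable_fun [set: X] h ->
  measurable [set x | h x < t].
Proof.
move=> mh; rewrite (_ : mkset _ = h @^-1` `]-oo, t[).
  by rewrite -[X in measurable X]setTI; exact: mh.
by apply/seteqP; split=> x; rewrite /preimage/= in_itv.
Qed.

Let mu_ : measurable_fun [set: X] u. Proof. exact: coord_measurable cu. Qed.

(** As [u] is uniformly distributed, [u] falls between [t] and [t + e] with probability at most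
    [e]. *)
Lemma coord_modulus (D : set X) t e : measurable D -> 0 <= e ->
  pr (D `&` [set x | u x < t + e]) <= pr (D `&` [set x | u x < t]) + e.
Proof.
move=> mD e0.
pose V s := [set x | u x < s].
have mV s : measurable (V s) by exact: measurable_sublevel.
have law s : 0 <= s <= 1 -> pr (V s) = s by move=> s01; exact: (coord_law cu s01).
have V_ge1 s : 1 <= s -> pr (V s) = 1.
  move=> s1; rewrite (_ : V s = setT) ?pr_setT//.
  apply/seteqP; split=> // x _; rewrite /V/=.
  by have /andP[_ h] := coord_itv cu x; exact: lt_le_trans s1.
have V_le0 s : s <= 0 -> pr (V s) = 0.
  move=> s0; rewrite (_ : V s = set0) ?pr_set0//.
  apply/seteqP; split=> // x; rewrite /V/= => h.
  by have /andP[h0 _] := coord_itv cu x; lra.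
have all_ s : pr (V (s + e)) <= pr (V s) + e.
  have [s0|s0] := leP s 0.
    rewrite (V_le0 s)//; have [s1|s1] := leP (s + e) 0; first by rewrite V_le0//; lra.
    have [s2|s2] := leP 1 (s + e); first by rewrite V_ge1//; lra.
    by rewrite law; lra.
  have [s1|s1] := leP 1 s; first by rewrite !V_ge1//; lra.
  rewrite (law s); last by lra.
  have [s2|s2] := leP 1 (s + e); first by rewrite V_ge1//; lra.
  by rewrite law; lra.
have VV : pr (V (t + e) `\` V t) <= e.
  have := all_ t; have := pr_split mu (mV (t + e)) (mV t).
  rewrite (_ : V (t + e) `&` V t = V t); first lra.
  apply/seteqP; split=> x; first by case.
  rewrite /V/= => h; split; last exact: h.
  by apply: lt_le_trans h _; rewrite lerDl.
apply: le_trans (_ : _ <= pr (D `&` V t) + pr (V (t + e) `\` V t)) _.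
  have mDV s : measurable (D `&` V s) by exact: measurableI.
  apply: (pr_leU mu (mDV (t + e)) (mDV t) (measurableD (mV _) (mV _))).
  by move=> x [Dx Vx]; have [?|?] := pselect (V t x); [left|right].
by rewrite lerD2l.
Qed.

(** For large [j], the event [l < t] lies between [h j < t - e] and [h j < t + e], whose measures on
    [C] are those for [u] on [D]; [coord_modulus] compares them with the threshold [t]. *)
Lemma limit_law (C D : set X) (h : nat -> X -> R) (l : X -> R) (k : nat) :
  measurable C -> measurable D -> (forall j, measurable_fun [set: X] (h j)) ->
  measurable_fun [set: X] l ->
  (forall j x, `|l x - h j x| <= 2 * (2 ^+ j)^-1) ->
  (forall j t, (k <= j)%N ->
    pr (C `&` [set x | h j x < t]) = pr (D `&` [set x | u x < t])) ->
  forall t, pr (C `&` [set x | l x < t]) = pr (D `&` [set x | u x < t]).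
Proof.
move=> mC mD mh ml lh CD t.
have mCs (E : set X) (g : X -> R) s : measurable E -> measurable_fun [set: X] g ->
    measurable (E `&` [set x | g x < s]).
  by move=> mE mg; apply: measurableI => //; exact: measurable_sublevel.
apply/eqP; rewrite eq_le; apply/andP; split; apply/ler_addgt0Pr => e e0.
all: have /exprV2_lt[i ie] : 0 < e / 2 by rewrite divr_gt0.
all: pose j := maxn k i.
all: have je : 2 * (2 ^+ j)^-1 <= e :> R.
1,3: by have : (2 ^+ j)^-1 <= (2 ^+ i)^-1 :> R;
  [rewrite lef_pV2 ?posrE ?exprn_gt0// ler_eXn2l ?ltr1n// leq_maxr|lra].
all: have kj : (k <= j)%N by exact: leq_maxl.
- apply: le_trans (coord_modulus t mD (ltW e0)); rewrite -(CD j)//.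
  apply: pr_le; [exact: mCs|exact: mCs|].
  move=> x [Cx lt]; split=> //=; rewrite /= in lt.
  by have := lh j x; rewrite ler_norml => /andP[]; lra.
- apply: le_trans (_ : _ <= pr (D `&` [set x | u x < t - e]) + e) _.
    by rewrite -{1}(subrK e t); apply: coord_modulus => //; exact: ltW.
  rewrite lerD2r -(CD j)//; apply: pr_le; [exact: mCs|exact: mCs|].
  move=> x [Cx lt]; split=> //=; rewrite /= in lt.
  by have := lh j x; rewrite ler_norml => /andP[]; lra.
Qed.

(** The image of [C] under [p j] is the same set for all [j >= k]. *)
Definition stable (p : nat -> inv_mpt mu) (C : set X) (k : nat) :=
  forall j, (k <= j)%N -> forall y, C (imt_inv (p j) y) <-> C (imt_inv (p k) y).

(** The uniform limit [l] of [u \o p j] has the law of [u], so [coord_realize] provides [alpha]. If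
    the image of [C] stabilizes at [D], then [l] on [C] has the law of [u] on [D], whence [C] is
    almost everywhere the preimage of [D] under [alpha]. *)
Lemma limit_map (p : nat -> inv_mpt mu) :
  (forall j x, same_dyadic j (u (p j.+1 x)) (u (p j x))) ->
  exists (alpha : X -> X) (l : X -> R), [/\ measure_preserving mu alpha,
    {ae mu, forall x, u (alpha x) = l x /\ X0 (alpha x)},
    forall j x, `|l x - u (p j x)| <= 2 * (2 ^+ j)^-1 &
    forall C k, measurable C -> stable p C k ->
      {ae mu, forall x, C x <-> C (imt_inv (p k) (alpha x))}].
Proof.
move=> Hu; have mup j : measurable_fun [set: X] (u \o p j).
  by apply: measurableT_comp => //; exact: (imt_measure_preserving (p j)).1.
have u0 x : 0 <= u x by have /andP[] := coord_itv cu x.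
have [|l ml lup] := @measurable_limit R _ X (fun j => u \o p j) mup.
  by move=> j x; exact: (same_dyadic_dist (u0 _) (u0 _) (Hu j x)).
have law C k : measurable C -> stable p C k -> forall t,
    pr (C `&` [set x | l x < t]) = pr (imt_inv (p k) @^-1` C `&` [set x | u x < t]).
  move=> mC sC; have mD : measurable (imt_inv (p k) @^-1` C).
    exact: imt_inv_preim_measurable.
  apply: (limit_law (k := k) mC mD mup ml lup) => j t kj.
  rewrite -[RHS](pr_imt (p j)); last first.
    by apply: measurableI => //; exact: measurable_sublevel.
  congr (pr _); apply/seteqP; split=> x [Cx ux]; split=> //.
    by rewrite /preimage/=; apply/(sC _ kj); rewrite imt_funK.
  by move: Cx; rewrite /preimage/= => /(sC _ kj); rewrite imt_funK.
have stableT : stable p setT 0 by [].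
have lawT t : pr [set x | l x < t] = pr [set x | u x < t].
  by have := law setT 0%N measurableT stableT t; rewrite preimage_setT !setTI.
have [alpha [N [malpha [mN N0] ulpha real]]] := coord_realize cu ml lawT.
have alpha_mp : measure_preserving mu alpha.
  split=> // A mA; have maA : measurable (alpha @^-1` A).
    by rewrite -[X in measurable X]setTI; exact: malpha.
  rewrite !(prE mu)//; congr EFin.
  have := real setT setT measurableT measurableT _ A mA; rewrite !setTI; apply.
  by move=> t; rewrite !setTI.
exists alpha, l; split=> //; first exact: ae_null mN N0 ulpha.
move=> C k mC sC; set D := imt_inv (p k) @^-1` C.
have mD : measurable D by exact: imt_inv_preim_measurable.
apply: (@ae_eq_of_prI _ _ _ _ C (alpha @^-1` D)) => //.
- exact: (mp_preim_measurable alpha_mp mD).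
- by rewrite (real C D mC mD (law C k mC sC) D mD) setIid pr_imt_inv.
- by rewrite /pr alpha_mp.2// -/(pr _) -/(pr _) pr_imt_inv.
Qed.

(** The sublevel sets of [u] at dyadic points of level [k] are stable from stage [k] on, so [u x] is
    close to [u] at the image of [alpha x] under the inverse of [p k], hence to
    [m (alpha x) = u (beta (alpha x))]. The conclusion follows by injectivity of [u]. *)
Lemma limit_inverse (p : nat -> inv_mpt mu) (alpha beta : X -> X) (m : X -> R) :
  (forall j x, same_dyadic j (u (imt_inv (p j.+1) x)) (u (imt_inv (p j) x))) ->
  measure_preserving mu alpha ->
  (forall C k, measurable C -> stable p C k ->
    {ae mu, forall x, C x <-> C (imt_inv (p k) (alpha x))}) ->
  {ae mu, forall x, u (beta x) = m x /\ X0 (beta x)} ->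
  (forall j x, `|m x - u (imt_inv (p j) x)| <= 2 * (2 ^+ j)^-1) ->
  {ae mu, forall x, beta (alpha x) = x}.
Proof.
move=> Hv alpha_mp Halpha ubeta mdist.
have u0 x : 0 <= u x by have /andP[] := coord_itv cu x.
have sd k j y : (k <= j)%N ->
    same_dyadic k (u (imt_inv (p j) y)) (u (imt_inv (p k) y)).
  move=> /subnK <-; elim: (j - k)%N => // n IH i.
  by rewrite addSn (same_dyadic_le (leq_addl n k) (Hv _ y) i); exact: IH.
have dy : {ae mu, forall x, forall k, same_dyadic k (u x) (u (imt_inv (p k) (alpha x)))}.
  apply: ae_foralln => k; apply: ae_foralln => i.
  apply: (Halpha [set y | u y < i%:R / 2 ^+ k] k) => [|j kj y].
    exact: measurable_sublevel.
  exact: sd.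
have X0ae : {ae mu, forall x, X0 x}.
  apply: (@ae_null _ _ _ _ (~` X0)); [|exact: coord_dom0 cu|by move=> x /contrapT].
  by apply: measurableC; exact: coord_dom cu.
apply: filterS3 (ae_pull alpha_mp ubeta) dy X0ae => x [ub Xb] dyx Xx.
apply: (coord_inj cu) => //; rewrite ub.
apply/eqP; rewrite -subr_eq0 -normr_le0; apply/ler_addgt0Pr => e e0.
have /exprV2_lt[k ke] : 0 < e / 3 by rewrite divr_gt0.
have := same_dyadic_dist (u0 _) (u0 _) (dyx k); have := mdist k (alpha x).
set w := u (imt_inv _ _) => h1 h2; rewrite add0r.
rewrite (_ : m (alpha x) - u x = (m (alpha x) - w) - (u x - w)); last by ring.
by have := ler_normB (m (alpha x) - w) (u x - w); lra.
Qed.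

Lemma limit_automorphism (p : nat -> inv_mpt mu) :
  (forall j x, same_dyadic j (u (p j.+1 x)) (u (p j x))) ->
  (forall j x, same_dyadic j (u (imt_inv (p j.+1) x)) (u (imt_inv (p j) x))) ->
  exists phi : inv_mpt mu, forall C k, measurable C -> stable p C k ->
    {ae mu, forall y, C (imt_inv phi y) <-> C (imt_inv (p k) y)}.
Proof.
move=> Hu Hv.
have [alpha [l [amp ua la Ca]]] := limit_map Hu.
have [beta [m [bmp ub mb Cb]]] := limit_map (p := fun j => imt_sym (p j)) Hv.
have ba := limit_inverse Hv amp Ca ub mb.
have ab := limit_inverse (p := fun j => imt_sym (p j)) Hu bmp Cb ua la.
have [phi Hphi] := imt_of_ae_inverse amp bmp ba ab.
exists phi => C k mC sC.
have H : {ae mu, forall x, C x <-> C (imt_inv (p k) (phi x))}.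
  by apply: filterS2 (Ca C k mC sC) Hphi => x h ->.
have := ae_pull (imt_inv_measure_preserving phi) H.
by apply: filterS => y; rewrite imt_invK.
Qed.

End limit_of_automorphisms.

(** * The dense Gdelta set *)

Section weak_topology_facts.
Context d (X : measurableType d) (R : realType) (mu : probability X R).
Local Notation pr := (pr mu).
Implicit Types (p q r : Phi mu) (A : set X).

Lemma Phi_imageE p A : Phi_image p A = imt_inv (repr p) @^-1` A.
Proof.
apply/seteqP; split=> [_ [x Ax <-]|x Ax]; first by rewrite /preimage/= imt_funK.
by exists (imt_inv (repr p) x) => //; rewrite imt_invK.
Qed.

Lemma Phi_image_class_of (phi : inv_mpt mu) A :
  {ae mu, forall y, Phi_image (class_of phi) A y <-> A (imt_inv phi y)}.
Proof.
have := ae_pull (imt_inv_measure_preserving phi) (repr_class_of phi).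
apply: filterS => y; rewrite imt_invK Phi_imageE /preimage/= => E.
by rewrite -{1}E imt_funK.
Qed.

Lemma nbhs_Phi_nbhs p A e : measurable A -> 0 < e -> nbhs p (Phi_nbhs p A e).
Proof.
move=> mA e0; rewrite nbhsE; exists (Phi_nbhs p A e) => //; split; last first.
  by rewrite /Phi_nbhs /= /setY setDv setU0 measure0 lte_fin.
exists [set Phi_nbhs p A e]; last by rewrite bigcup_set1.
move=> _ ->; exists [fset Phi_nbhs p A e]%fset.
  by move=> V /fset1P ->; apply/mem_set; exists p, A, e.
by rewrite eqEsubset; split => q /=; [move=> h; apply: h; exact/fset1P|
   move=> Hq V /fset1P ->].
Qed.

Let mY A B : measurable A -> measurable B -> measurable (A `+` B).
Proof. by move=> mA mB; apply: measurableU; exact: measurableD. Qed.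

(** A basic neighbourhood constrains the images of finitely many sets only, so for density it
    suffices to preserve those images up to null sets. *)
Lemma nbhs_Phi_ae p (U : set (Phi mu)) : nbhs p U ->
  exists s : seq (set X), (forall A, A \in s -> measurable A) /\
    forall q, (forall A, A \in s ->
      {ae mu, forall y, Phi_image q A y <-> Phi_image p A y}) -> U q.
Proof.
rewrite nbhsE => -[_ [[B sB <-] [C BC Cp]] sU].
have /sB[D sD IDeC] := BC.
have /choice[a Ha] (E : set (Phi mu)) : exists A, E \in D ->
    measurable A /\ forall q,
      {ae mu, forall y, Phi_image q A y <-> Phi_image p A y} -> E q.
  have [DE|] := boolP (E \in D); last by exists set0.
  have /sD := DE; rewrite inE => -[r [A [e [mA e0 EE]]]].
  have : E p by move: Cp; rewrite -IDeC => /(_ _ DE).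
  rewrite EE => pr_; exists A => _; split=> // q qp.
  have mq := measurable_Phi_image q mA; have mr := measurable_Phi_image r mA.
  have mp := measurable_Phi_image p mA.
  rewrite /Phi_nbhs /=; move: pr_; rewrite /Phi_nbhs /= !(prE mu) ?lte_fin; try exact: mY.
  congr (_ < _); apply: pr_ae_eq; [exact: mY|exact: mY|].
  by apply: filterS qp => y H; rewrite /setY /setU /setD /=; tauto.
exists [seq a E | E <- D]; split=> [A /mapP[E ED ->]|q Hq].
  by have [] := Ha E ED.
apply: sU; exists C; first exact: BC.
have qD : (\bigcap_(E in [set` D]) E) q.
  by move=> E ED; apply: (Ha E ED).2; apply: Hq; apply/mapP; exists E.
by rewrite -IDeC; exact: qD.
Qed.

End weak_topology_facts.

(** * Generic failure of uniform mixing *)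

Section generic_nonuniform_mixing.
Context d (X : measurableType d) (R : realType) (mu : probability X R).
Variable T : inv_mpt mu.
Hypothesis T_mixing : strong_mixing mu T.
Local Notation pr := (pr mu).
Variables (F : set (set X)) (e : R).
Hypothesis F_measurable : forall C, F C -> measurable C.
Hypothesis e_gt0 : 0 < e.
Hypothesis F_rich : forall (K : finType) (a : X -> K), label a ->
  exists2 C, F C & forall P, e <= pr (mismatch a C P).
Variables (u : X -> R) (X0 : set X).
Hypothesis cu : coordinate mu u X0.

Let T_mp := imt_measure_preserving T.

Lemma gap_ae_eq n (A B : set X) : measurable A -> measurable B ->
  {ae mu, forall x, A x <-> B x} -> gap mu T n A A = gap mu T n B B.
Proof.
move=> mA mB AB; rewrite /gap (pr_ae_eq mA mB AB); congr (_ - _).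
have mT C : measurable C -> measurable (iter n T @^-1` C) by exact: (measurable_preim T_mp).
apply: pr_ae_eq; [by apply: measurableI => //; exact: mT..|].
apply: filterS2 AB (ae_pull (measure_preserving_iter T_mp n) AB) => x h1 h2.
by rewrite /setI /preimage/=; tauto.
Qed.

Lemma perturbation_dyadic (G0 : set X) (phi : inv_mpt mu) (s : seq (set X)) (j : nat) :
  measurable G0 -> 0 < pr G0 -> 4 * pr G0 <= e ^+ 2 ->
  (forall A, A \in s -> measurable A) ->
  exists C (n : nat) (phi' : inv_mpt mu), [/\ F C, (j <= n)%N,
    pr G0 * e ^+ 2 / 16 < `|gap mu T n (imt_inv phi' @^-1` C) (imt_inv phi' @^-1` C)|,
    (forall x, same_dyadic j (u (phi' x)) (u (phi x))) /\
    (forall y, same_dyadic j (u (imt_inv phi' y)) (u (imt_inv phi y))) &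
    forall A, A \in s -> forall y, A (imt_inv phi' y) <-> A (imt_inv phi y)].
Proof.
move=> mG0 g0 ge ms.
pose J i := [set x | u x < i%:R / 2 ^+ j].
have mJ i : measurable (J i).
  exact: measurable_sublevel (coord_measurable cu).
(* As [u < 1], only finitely many dyadic thresholds matter. *)
have J_big i : (2 ^ j <= i)%N -> J i = setT.
  move=> ji; apply/seteqP; split=> // x _; rewrite /J/=.
  have /andP[_ h] := coord_itv cu x; apply: lt_le_trans h _.
  by rewrite ler_pdivlMr ?exprn_gt0// mul1r -natrX ler_nat.
pose img (A : set X) := imt_inv phi @^-1` A.
have mimg A : measurable A -> measurable (img A) by exact: imt_inv_preim_measurable.
pose dy := [seq J i | i <- iota 0 (2 ^ j)].
(* Preserving the dyadic sets controls [u \o phi'], preserving their images under [phi] controls [u]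
   composed with the inverse, and the last block freezes the images of the sets in [s]. *)
pose L := dy ++ [seq img A | A <- dy] ++ [seq img A | A <- s].
have mL A : A \in L -> measurable A.
  rewrite !mem_cat => /or3P[/mapP[i _ ->]//|/mapP[B /mapP[i _ ->] ->]|/mapP[B Bs ->]].
    exact: mimg.
  by apply: mimg; exact: ms.
have lL : label (name (nth set0 L) (size L)).
  apply: label_name => i; have [iL|iL] := ltnP i (size L).
    by apply: mL; exact: mem_nth.
  by rewrite nth_default.
have [C [n [psi [FC jn psiL gapC]]]] :=
  perturbation T_mixing F_measurable e_gt0 F_rich phi j lL mG0 g0 ge.
have keep A : A \in L -> forall x, A (psi x) <-> A x.
  move=> AL x; have iL : (index A L < size L)%N by rewrite index_mem.
  have /ffunP/(_ (Ordinal iL)) := psiL x; rewrite !ffunE /= nth_index//.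
  by move=> E; split=> /asboolP; [rewrite E|rewrite -E] => /asboolP.
have keepJ i x : J i (psi x) <-> J i x.
  have [ji|ij] := leqP (2 ^ j) i; first by rewrite J_big.
  by apply: keep; rewrite mem_cat; apply/orP; left; apply/mapP; exists i; rewrite // mem_iota.
have keep_img A : (forall x, img A (psi x) <-> img A x) ->
    forall y, A (imt_inv (imt_comp psi phi) y) <-> A (imt_inv phi y).
  by move=> H y; have := H (imt_inv psi y); rewrite imt_invK /img /preimage/= => ->.
exists C, n, (imt_comp psi phi); split=> //.
  split=> [x i|y i]; first exact: (keepJ i (phi x)).
  apply: (keep_img (J i)) => x; have [ji|ij] := leqP (2 ^ j) i; first by rewrite J_big.
  apply: keep; rewrite !mem_cat; apply/or3P/Or32/mapP; exists (J i) => //.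
  by apply/mapP; exists i; rewrite // mem_iota.
move=> A As; apply: keep_img => x; apply: keep.
by rewrite !mem_cat; apply/or3P/Or33/mapP; exists A.
Qed.

Section dense_Gdelta.
Variable G0 : set X.
Hypotheses (mG0 : measurable G0) (g_gt0 : 0 < pr G0) (g_le : 4 * pr G0 <= e ^+ 2).
Let delta := pr G0 * e ^+ 2 / 16.

(** The gap of the conjugate of [T] at [C] is the gap of [T] at the image of [C]; this form depends
    only on the class and is visibly continuous in it. *)
Definition badly_mixing (N : nat) : set (Phi mu) :=
  [set q | exists n C, [/\ (N <= n)%N, F C &
     delta < `|gap mu T n (Phi_image q C) (Phi_image q C)|]].

Lemma open_badly_mixing N : open (badly_mixing N).
Proof.
rewrite openE => q [n [C [Nn FC dC]]]; have mC := F_measurable FC.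
(* A change of measure less than [k] moves the gap by at most [2 * (k + k)], half of its excess over
   [delta]. *)
pose k := (`|gap mu T n (Phi_image q C) (Phi_image q C)| - delta) / 8.
have k0 : 0 < k by rewrite divr_gt0// subr_gt0.
rewrite /interior; apply: filterS (nbhs_Phi_nbhs q mC k0) => r /= rq.
exists n, C; split=> //.
have mq := measurable_Phi_image q mC; have mr := measurable_Phi_image r mC.
have mM : measurable (Phi_image r C `+` Phi_image q C).
  by apply: measurableU; exact: measurableD.
have prM : pr (Phi_image r C `+` Phi_image q C) < k by rewrite -lte_fin -prE.
have sub (A B : set X) : A `<=` B `|` (A `+` B) /\ B `<=` A `|` (A `+` B).
  by split=> x Hx; rewrite /setY /setU /setD/=; have [?|?] := pselect (A x);
    have [?|?] := pselect (B x); tauto.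
have [s1 s2] := sub (Phi_image r C) (Phi_image q C).
have := gap_perturb T_mp n mq mq mr mr mM mM s2 s1 s2 s1.
rewrite /k in prM; lra.
Qed.

(** Starting in [O], stage [j] produces a bad time at least [j] and a bad set, and all later stages
    keep the image of that set. The limit inherits every bad pair and stays in [O]. *)
Lemma dense_badly_mixing : dense (\bigcap_N badly_mixing N).
Proof.
move=> O [p0 Op0] oO.
have [s [ms sO]] : exists s : seq (set X), (forall A, A \in s -> measurable A) /\
    forall q, (forall A, A \in s ->
      {ae mu, forall y, Phi_image q A y <-> Phi_image p0 A y}) -> O q.
  by apply: nbhs_Phi_ae; apply: open_nbhs_nbhs.
have /choice[step Hstep] (a : nat * (inv_mpt mu * seq (set X))) :
    exists b : set X * nat * inv_mpt mu, (forall A, A \in a.2.2 -> measurable A) ->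
    [/\ F b.1.1, (a.1 <= b.1.2)%N,
    delta < `|gap mu T b.1.2 (imt_inv b.2 @^-1` b.1.1) (imt_inv b.2 @^-1` b.1.1)|,
    (forall x, same_dyadic a.1 (u (b.2 x)) (u (a.2.1 x))) /\
    (forall y, same_dyadic a.1 (u (imt_inv b.2 y)) (u (imt_inv a.2.1 y))) &
    forall A, A \in a.2.2 -> forall y, A (imt_inv b.2 y) <-> A (imt_inv a.2.1 y)].
  case: a => j [phi L] /=.
  have [mL|nmL] := pselect (forall A, A \in L -> measurable A); last first.
    by exists (set0, 0%N, phi).
  have [C [n [phi' H]]] := perturbation_dyadic phi j mG0 g_gt0 g_le mL.
  by exists (C, n, phi').
(* The state consists of the current automorphism and the list of sets whose images are frozen from
   then on. *)
pose fix st j : inv_mpt mu * seq (set X) := if j is i.+1 then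
  ((step (i, st i)).2, (step (i, st i)).1.1 :: (st i).2) else (repr p0, s).
pose p j := (st j).1.
have mst j A : A \in (st j).2 -> measurable A.
  elim: j A => [|j IH] A /=; first exact: ms.
  have [FC _ _ _ _] := Hstep (j, st j) IH.
  by rewrite inE => /predU1P[->|/IH//]; exact: F_measurable.
have st_sub k j A : (k <= j)%N -> A \in (st k).2 -> A \in (st j).2.
  move=> /subnK <- Ak; elim: (j - k)%N => // n IH.
  by rewrite addSn /= inE IH orbT.
have stable_st k A : A \in (st k).2 -> stable p A k.
  move=> Ak j /subnK <- y; elim: (j - k)%N => // n IH.
  have [_ _ _ _] := Hstep ((n + k)%N, st (n + k)%N) (mst _).
  by move=> /(_ A (st_sub _ _ _ (leq_addl n k) Ak) y); rewrite -IH.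
have Hu j x : same_dyadic j (u (p j.+1 x)) (u (p j x)).
  by have [_ _ _ [H _] _] := Hstep (j, st j) (mst j); exact: H.
have Hv j x : same_dyadic j (u (imt_inv (p j.+1) x)) (u (imt_inv (p j) x)).
  by have [_ _ _ [_ H] _] := Hstep (j, st j) (mst j); exact: H.
have [phi Hphi] := limit_automorphism cu Hu Hv.
have image k A : A \in (st k).2 ->
    {ae mu, forall y, Phi_image (class_of phi) A y <-> A (imt_inv (p k) y)}.
  move=> Ak; have mA := mst _ _ Ak.
  apply: filterS2 (Phi_image_class_of phi A) (Hphi A k mA (stable_st k A Ak)) => y.
  by move=> -> ->.
exists (class_of phi); split.
  by apply: sO => A As; rewrite (Phi_imageE p0); exact: (image 0%N).
move=> N _; have [FC Nn dC _ _] := Hstep (N, st N) (mst N).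
set C := (step (N, st N)).1.1 in FC dC; set n := (step (N, st N)).1.2 in Nn dC.
exists n, C; split=> //.
(* [C] is frozen together with [p N.+1], the automorphism for which its gap was made large. *)
have CN : C \in (st N.+1).2 by rewrite /= mem_head.
have mC := F_measurable FC.
rewrite (@gap_ae_eq _ _ (imt_inv (p N.+1) @^-1` C))//.
- exact: measurable_Phi_image.
- exact: imt_inv_preim_measurable.
- exact: image.
Qed.

Lemma limsup_badly_mixing (phi : inv_mpt mu) :
  (\bigcap_N badly_mixing N) (class_of phi) ->
  (0 < limn_esup (fun n =>
    ereal_sup [set mixing_gap mu (conjugate T phi) n C C | C in F]))%E.
Proof.
move=> Hphi; apply: (@lt_le_trans _ _ delta%:E).
  by rewrite lte_fin divr_gt0// mulr_gt0// exprn_gt0.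
apply: limn_esup_ge => N; have [n [C [Nn FC dC]]] := Hphi N I.
exists n => //; apply: le_trans (_ : mixing_gap mu (conjugate T phi) n C C <= _)%E; last first.
  by apply: ereal_sup_ubound; exists C.
have mC := F_measurable FC.
pose S : inv_mpt mu := imt_comp (imt_sym phi) (imt_comp T phi).
rewrite -[conjugate T phi]/(imt_fun S) (mixing_gapE (imt_measure_preserving S))//.
rewrite lee_fin ltW//; apply: lt_le_trans dC _.
pose D := imt_inv phi @^-1` C.
have mD : measurable D by exact: imt_inv_preim_measurable.
rewrite (gap_ae_eq n (measurable_Phi_image _ mC) mD); last exact: Phi_image_class_of.
have SE x : iter n S x = imt_inv phi (iter n T (phi x)).
  by elim: (n) => [|k IH] /=; rewrite ?imt_funK// IH imt_invK.
rewrite /gap (pr_imt_inv phi mC) -(pr_imt phi (A := D `&` iter n T @^-1` D)).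
  rewrite (_ : phi @^-1` (D `&` iter n T @^-1` D) = C `&` iter n S @^-1` C)//.
  by apply/seteqP; split=> x; rewrite /D /setI /preimage/= imt_funK SE.
by apply: measurableI => //; exact: (measurable_preim T_mp).
Qed.

End dense_Gdelta.

End generic_nonuniform_mixing.

(** * The dichotomy applied to families of zero and of positive entropy *)

Local Open Scope ereal_scope.

Theorem corollary1 (d : measure_display) (X : measurableType d) (R : realType)
    (mu : probability X R) (T : X -> X) (F : set (set X))
    (T_mp : measure_preserving mu T) (T_mixing : strong_mixing mu T)
    (F_measurable : forall A, F A -> measurable A) :
  (family_entropy mu F = 0 ->
     ereal_sup [set mixing_gap mu T n A B | A in F & B in F]
       @[n --> \oo] --> 0) /\
  (invertible mu T -> lebesgue_space mu -> 0 < family_entropy mu F ->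
     exists G : set (Phi mu),
       [/\ Gdelta G, dense G &
         forall phi : inv_mpt mu, G (class_of phi) ->
           0 < limn_esup (fun n =>
             ereal_sup [set mixing_gap mu (conjugate T phi) n C C | C in F])]).
Proof.
split=> [F0|T_invertible mu_lebesgue Fpos].
  apply: cvg_sup_mixing_gap => //.
    (* An empty family has entropy [-oo], not 0. *)
    apply/set0P/negP => /eqP F_empty; move: F0.
    rewrite /family_entropy [X in ereal_sup X](_ : _ = set0) ?ereal_sup0//.
    by apply/seteqP; split=> // x [C FC _]; have := FC 0%N; rewrite F_empty.
  by apply: approximable_of_entropy0 => //; rewrite F0.
have [phi_T phi_TE] := T_invertible.
have [u [X0 cu]] := lebesgue_coordinate mu_lebesgue; subst T.
have [e e0 F_rich] : exists2 e : R, (0 < e)%R &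
    forall (K : finType) (a : X -> K), label a ->
      exists2 C, F C & forall P, (e <= pr mu (mismatch a C P))%R.
  apply: not_approximable => /(entropy_le0_of_approximable F_measurable).
  by rewrite leNgt Fpos.
(* The coordinate provides a set of measure exactly [g]; the bound by 1 keeps [g] in the range of
   [coord_law]. *)
pose g : R := (Num.min 1 (e ^+ 2 / 4))%R.
have g0 : (0 < g)%R by rewrite lt_min ltr01 divr_gt0// exprn_gt0.
have prg : pr mu [set x | (u x < g)%R] = g.
  by rewrite (coord_law cu)// (ltW g0)/= ge_min lexx.
have mg : measurable [set x | (u x < g)%R].
  exact: measurable_sublevel (coord_measurable cu).
have prg0 : (0 < pr mu [set x | (u x < g)%R])%R by rewrite prg.
have prg_le : (4 * pr mu [set x | (u x < g)%R] <= e ^+ 2)%R.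
  by rewrite prg mulrC -ler_pdivlMr// ge_min lexx orbT.
exists (\bigcap_N badly_mixing phi_T F e [set x | (u x < g)%R] N); split.
- by exists (badly_mixing phi_T F e [set x | (u x < g)%R]) => // N; exact: open_badly_mixing.
- exact: (dense_badly_mixing T_mixing F_measurable e0 F_rich cu mg prg0 prg_le).
- by move=> phi; exact: limsup_badly_mixing.
Qed.
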